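(* Let $p\ge2$, $c>0$, and let $H_N$ be the $p$-uniform Erdős–Rényi hypergraph on $\{1,\dots,N\}$ with parameter $\alpha_N=c/N^{p-1}$. Then, as $N\to\infty$, $H_N$ converges locally weakly to the uniform Galton–Watson hypertree with offspring distribution $\mathrm{Poi}\left(c/(p-1)!\right)$.
   Context: The $p$-uniform Erdős–Rényi hypergraph on $\{1,\dots,N\}$ with parameter $\alpha\in(0,1)$ is the random simple hypergraph in which each subset $\{i_1<\cdots<i_p\}$ of $\{1,\dots,N\}$ is a hyperedge with probability $\alpha$, independently for all such subsets. (It is considered for $N$ large enough that $\alpha_N\in(0,1)$.) Local weak convergence: let $\mathcal{H}^*$ be the set of isomorphism classes $[H,o]$ of connected, locally finite, simple rooted hypergraphs $(H,o)$ (isomorphisms preserve the root). For $r\ge 0$, $(H,o)_r$ is the rooted hypergraph formed by the vertices at distance at most $r$ from $o$ (distance in the graph where two vertices are adjacent if they share a hyperedge) and the hyperedges contained in this set of vertices. $\mathcal{H}^*$ is endowed with the local topology, generated by the sets $A_r(X,v)=\{[H,o]\in\mathcal{H}^*: (H,o)_r\equiv (X,v)\}$, $r\ge1$, where $\equiv$ denotes rooted isomorphism. For a vertex $i$ of $H_N$, let $H_N(i)$ be the connected component of $i$ in $H_N$, and let $\mu_N=\mathbb{E}\left[\frac1N\sum_{i=1}^N\delta_{[H_N(i),i]}\right]$, a probability measure on $\mathcal{H}^*$. $H_N$ converges locally weakly to a random rooted hypergraph of law $\mu$ on $\mathcal{H}^*$ if $\mu_N\to\mu$ weakly. The uniform Galton–Watson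 hypertree with offspring distribution $\mathrm{Poi}(\lambda)$ is the random rooted $p$-uniform hypertree in which the root is contained in a $\mathrm{Poi}(\lambda)$-distributed number of offspring hyperedges, each offspring hyperedge contains $p-1$ new vertices besides its parent vertex, and each new vertex independently has a $\mathrm{Poi}(\lambda)$-distributed number of offspring hyperedges, and so on recursively (for the Poisson law, the size-biased offspring law of non-root vertices coincides with the offspring law of the root). *)

(* Defs.v *)
From HB Require Import structures.
From mathcomp Require Import all_boot all_order all_algebra.
From mathcomp Require Import finmap.
From mathcomp Require Import all_classical all_reals all_analysis.
From mathcomp Require Import measurable_realfun.

Set Implicit Arguments.
Unset Strict Implicit.
Unset Printing Implicit Defensive.
Import Order.TTheory GRing.Theory Num.Theory.
Import numFieldNormedType.Exports.

Local Open Scope classical_set_scope.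
Local Open Scope ring_scope.
Local Open Scope quotient_scope.

(* Edges form a set of sets of vertices: there are no multiple edges. *)
Record hypergraph (T : Type) := Hypergraph {
  hverts : set T;
  hedges : set (set T);
  hedges_sub : forall e, hedges e -> e `<=` hverts;
  hedges_neq0 : forall e, hedges e -> e !=set0 }.

Section hypergraph.
Context {T : Type}.
Implicit Types (H : hypergraph T) (x y o : T).

Definition hadj H x y := exists2 e, hedges H e & e x /\ e y.

Fixpoint hdist_le H (r : nat) x y : Prop :=
  if r is s.+1 then exists2 z, x = z \/ hadj H x z & hdist_le H s z y
  else x = y.

Definition hconnected H :=
  forall x y, hverts H x -> hverts H y -> exists r, hdist_le H r x y.

Definition locally_finite H :=
  (forall x, finite_set [set e | hedges H e /\ e x]) /\
  (forall e, hedges H e -> finite_set e).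

Lemma induced_sub H (A : set T) e :
  (hedges H e /\ e `<=` A) -> e `<=` hverts H `&` A.
Proof.
by move=> [He eA] x ex; split; [exact: hedges_sub He _ ex|exact: eA].
Qed.

Lemma induced_neq0 H (A : set T) e : (hedges H e /\ e `<=` A) -> e !=set0.
Proof. by case=> /hedges_neq0. Qed.

Definition induced H (A : set T) : hypergraph T :=
  Hypergraph (@induced_sub H A) (@induced_neq0 H A).

(* The hypergraph underlying (H, o)_r. *)
Definition hball H o (r : nat) := induced H [set x | hdist_le H r o x].

Lemma hadj_sym H x y : hadj H x y -> hadj H y x.
Proof. by move=> [e He [ex ey]]; exists e. Qed.

Lemma hdist_le_trans H r s x y z :
  hdist_le H r x y -> hdist_le H s y z -> hdist_le H (r + s) x z.
Proof.
elim: r x => [x -> //|r IH x /= [t xt ty] yz].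
by exists t => //; exact: IH ty yz.
Qed.

Lemma hdist_le_sym H r x y : hdist_le H r x y -> hdist_le H r y x.
Proof.
elim: r x => [x -> //|r IH x [t xt /IH ty]].
rewrite -[r.+1]addn1; apply: hdist_le_trans ty _ => /=.
by exists x => //; case: xt => [->|/hadj_sym]; [left|right].
Qed.

End hypergraph.

Definition rooted_iso {T T' : Type} (H : hypergraph T) (o : T)
    (H' : hypergraph T') (o' : T') :=
  exists f : T -> T',
    [/\ set_bij (hverts H) (hverts H') f,
        hedges H' = [set f @` e | e in hedges H] & f o = o'].

Lemma rooted_iso_refl T (H : hypergraph T) o : rooted_iso H o H o.
Proof.
exists id; split => //; first by split => // x; exists x.
by apply/seteqP; split => [e He|_ [e He <-]]; [exists e|]; rewrite ?image_id.
Qed.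

Lemma rooted_iso_trans T T' T'' (H : hypergraph T) o (H' : hypergraph T') o'
    (H'' : hypergraph T'') o'' :
  rooted_iso H o H' o' -> rooted_iso H' o' H'' o'' -> rooted_iso H o H'' o''.
Proof.
move=> [f [fb fE fo]] [g [gb gE go]]; exists (g \o f); split => /=.
- exact: set_bij_comp fb gb.
- rewrite gE fE; apply/seteqP; split => [_ [_ [e He <-] <-]|_ [e He <-]].
    by exists e => //; rewrite image_comp.
  by exists (f @` e); [exists e|rewrite image_comp].
- by rewrite fo.
Qed.

Lemma rooted_iso_sym T T' (H : hypergraph T) o (H' : hypergraph T') o' :
  hverts H o -> rooted_iso H o H' o' -> rooted_iso H' o' H o.
Proof.
move=> Ho [f [[fV fi fs] fE fo]].
have /choice[g gP] : forall y, exists x, hverts H' y -> hverts H x /\ f x = y.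
  move=> y; have [Hy|] := pselect (hverts H' y); last by exists o.
  by have [x Hx <-] := fs _ Hy; exists x.
have gK x : hverts H x -> g (f x) = x.
  move=> Hx; have [Hg Eg] := gP _ (fV _ Hx).
  by apply: fi => //; rewrite inE.
exists g; split.
- split.
  + by move=> y /gP[].
  + move=> x y; rewrite !inE => /gP[_ {2}<-] /gP[_ {2}<-] ->; done.
  + by move=> x Hx; exists (f x); [exact: fV|exact: gK].
- have gfE e : hedges H e -> g @` (f @` e) = e.
    move=> He; apply/seteqP; split => [_ [_ [x ex <-] <-]|x ex].
      by rewrite gK //; exact: hedges_sub He _ ex.
    exists (f x); first exact: imageP.
    by rewrite gK //; exact: hedges_sub He _ ex.
  rewrite fE; apply/seteqP; split => [e He|_ [_ [e He <-] <-]].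
    by exists (f @` e); [exists e|exact: gfE].
  by rewrite gfE.
- by rewrite -fo gK.
Qed.

Record rooted_hypergraph (T : Type) := RootedHypergraph {
  rh_graph :> hypergraph T;
  rh_root : T;
  rh_rootP : hverts rh_graph rh_root;
  rh_conn : hconnected rh_graph;
  rh_lf : locally_finite rh_graph }.

Section relabel.
Context {T T' : Type} (f : T -> T').
Implicit Types H : hypergraph T.

Lemma relabel_sub H e :
  [set f @` a | a in hedges H] e -> e `<=` f @` hverts H.
Proof. by move=> [a Ha <-]; apply: image_subset; exact: hedges_sub Ha. Qed.

Lemma relabel_neq0 H e : [set f @` a | a in hedges H] e -> e !=set0.
Proof. by move=> [a /hedges_neq0 [x ax] <-]; exists (f x); exact: imageP. Qed.

Definition relabel H : hypergraph T' :=
  Hypergraph (@relabel_sub H) (@relabel_neq0 H).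

Lemma hdist_le_relabel H r x y :
  hdist_le H r x y -> hdist_le (relabel H) r (f x) (f y).
Proof.
elim: r x => [x -> //|r IH x /= [z xz /IH zy]]; exists (f z) => //.
case: xz => [->|[e He [ex ez]]]; [by left|right].
by exists (f @` e); [exists e|split; exact: imageP].
Qed.

Lemma relabel_conn H : hconnected H -> hconnected (relabel H).
Proof.
move=> cH _ _ [x Hx <-] [y Hy <-]; have [r xy] := cH _ _ Hx Hy.
by exists r; exact: hdist_le_relabel.
Qed.

Hypothesis f_inj : injective f.

Lemma relabel_lf H : locally_finite H -> locally_finite (relabel H).
Proof.
move=> [dH eH]; split; last first.
  by move=> _ [e He <-]; apply: finite_image; exact: eH.
move=> y; have [[x fxy]|nxy] := pselect (exists x, f x = y).
  apply: sub_finite_set (finite_image (fun e => f @` e) (dH x)).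
  move=> _ [[e He <-] [x' ex' fx'y]]; exists e => //; split => //.
  by rewrite (_ : x = x') //; apply: f_inj; rewrite fxy.
apply: sub_finite_set (finite_set0 _) => _ [[e He <-] [x ex fxy]].
by apply: nxy; exists x.
Qed.

Lemma relabel_root (G : rooted_hypergraph T) :
  hverts (relabel G) (f (rh_root G)).
Proof. exact: imageP (rh_rootP G). Qed.

Definition rrelabel (G : rooted_hypergraph T) : rooted_hypergraph T' :=
  RootedHypergraph (relabel_root G) (relabel_conn (rh_conn (r:=G)))
    (relabel_lf (rh_lf G)).

Lemma rrelabel_iso (G : rooted_hypergraph T) :
  rooted_iso G (rh_root G) (rrelabel G) (rh_root (rrelabel G)).
Proof.
exists f; split => //; split; first by move=> x Gx; exact: imageP.
  by move=> x y _ _; exact: f_inj.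
by [].
Qed.

End relabel.

HB.instance Definition _ := gen_eqMixin (rooted_hypergraph nat).
HB.instance Definition _ := gen_choiceMixin (rooted_hypergraph nat).

Definition rh_isob (G G' : rooted_hypergraph nat) : bool :=
  `[< rooted_iso G (rh_root G) G' (rh_root G') >].

Lemma rh_isob_refl : reflexive rh_isob.
Proof. by move=> G; apply/asboolP; exact: rooted_iso_refl. Qed.

Lemma rh_isob_sym : symmetric rh_isob.
Proof.
by move=> G G'; apply/asbool_equiv_eq; split; apply: rooted_iso_sym;
   exact: rh_rootP.
Qed.

Lemma rh_isob_trans : transitive rh_isob.
Proof.
move=> G G' G'' /asboolP GG' /asboolP G'G''.
by apply/asboolP; exact: rooted_iso_trans GG' G'G''.
Qed.

Canonical rh_iso_equiv :=
  EquivRel rh_isob rh_isob_refl rh_isob_sym rh_isob_trans.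

(* The set H^* of isomorphism classes. Connected locally finite hypergraphs
   are countable, so vertex sets included in nat represent every class. *)
Definition Hstar := {eq_quot rh_iso_equiv}.
HB.instance Definition _ := Choice.on Hstar.
HB.instance Definition _ := EqQuotient.on Hstar.

(* [H, o], for hypergraphs on any countable type. *)
Definition iso_class (T : countType) (G : rooted_hypergraph T) : Hstar :=
  \pi_Hstar (rrelabel (pcan_inj (@choice.pickleK T)) G).

Lemma iso_classP (T T' : countType) (G : rooted_hypergraph T)
    (G' : rooted_hypergraph T') :
  iso_class G = iso_class G' <-> rooted_iso G (rh_root G) G' (rh_root G').
Proof.
have GI := rrelabel_iso (pcan_inj (@choice.pickleK T)) G.
have GI' := rrelabel_iso (pcan_inj (@choice.pickleK T')) G'.
split=> [/eqmodP/asboolP GG'|GG'].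
  apply: rooted_iso_trans GI (rooted_iso_trans GG' _).
  exact: rooted_iso_sym (rh_rootP _) GI'.
apply/eqmodP/asboolP; apply: rooted_iso_trans (rooted_iso_trans GG' GI').
exact: rooted_iso_sym (rh_rootP _) GI.
Qed.

(* The set A_r(X, v). *)
Definition local_ball (r : nat) (X : hypergraph nat) (v : nat) : set Hstar :=
  [set iso_class G | G in [set G : rooted_hypergraph nat |
    rooted_iso (hball G (rh_root G) r) (rh_root G) X v]].

Definition local_balls : set (set Hstar) :=
  [set A | exists r X v, [/\ (0 < r)%N, hverts X v & A = local_ball r X v]].

Section single_vertex.
Let H0 := @Hypergraph nat [set 0%N] set0 (fun e F => False_ind _ F)
  (fun e F => False_ind _ F).
Let conn0 : hconnected H0. Proof. by move=> _ _ -> ->; exists 0%N. Qed.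
Let lf0 : locally_finite H0.
Proof.
by split=> // x; apply: sub_finite_set (finite_set0 _) => e [].
Qed.

Definition single_vertex : rooted_hypergraph nat :=
  RootedHypergraph (erefl : hverts H0 0%N) conn0 lf0.

End single_vertex.

HB.instance Definition _ := isPointed.Build Hstar (iso_class single_vertex).

HB.instance Definition _ := @isSubBaseTopological.Build Hstar _ local_balls id.

HB.instance Definition _ :=
  Measurable.copy Hstar (g_sigma_algebraType (@open Hstar)).

Lemma rooted_iso_eq T (H H' : hypergraph T) o :
  hverts H = hverts H' -> hedges H = hedges H' -> rooted_iso H o H' o.
Proof.
move=> VE EE; have [f [fV fE fo]] := rooted_iso_refl H o.
by exists f; split; rewrite -?VE -?EE.
Qed.

Lemma hdist_le_finite T (H : hypergraph T) r x :
  locally_finite H -> finite_set [set y | hdist_le H r x y].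
Proof.
move=> [vH eH]; elim: r x => [x|r IH x].
  by apply: sub_finite_set (finite_set1 x) => y /= ->.
pose N := [set x] `|` \bigcup_(e in [set e | hedges H e /\ e x]) e.
apply: (@sub_finite_set _ _ (\bigcup_(z in N) [set y | hdist_le H r z y])).
  move=> y /= [z xz zy]; exists z => //.
  by case: xz => [<-|[e He [ex ez]]]; [left|right; exists e].
apply: bigcup_finite; last by move=> z _; exact: IH.
rewrite finite_setU; split; first exact: finite_set1.
by apply: bigcup_finite => // e [He _]; exact: eH.
Qed.

Lemma hball_iso T T' (H : hypergraph T) o (H' : hypergraph T') o' r :
  hverts H o -> rooted_iso H o H' o' ->
  rooted_iso (hball H o r) o (hball H' o' r) o'.
Proof.
move=> Ho [f [[fV fi fs] fE fo]].
have inj x y : hverts H x -> hverts H y -> f x = f y -> x = y.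
  by move=> Hx Hy; apply: fi; rewrite inE.
have dist x y s : hverts H x -> hverts H y ->
    hdist_le H s x y <-> hdist_le H' s (f x) (f y).
  elim: s x => [x Hx Hy|s IH x Hx Hy]; first by split=> [->|/inj]//; exact.
  split=> /= -[z xz zy].
    have Hz : hverts H z.
      by case: xz => [<-//|[e He [_ ez]]]; exact: hedges_sub He _ ez.
    exists (f z); last exact/IH.
    case: xz => [->|[e He [ex ez]]]; [by left|right].
    by exists (f @` e); [rewrite fE; exists e|split; exact: imageP].
  case: xz => [xz|[e' He' [xe' ze']]].
    by exists x; [left|apply/IH => //; rewrite xz].
  move: He' xe' ze'; rewrite fE => -[e He <-] [x1 ex1 fx1] [z1 ez1 fz1].
  subst z; exists z1; last by apply/IH => //; exact: hedges_sub He _ ez1.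
  right; exists e => //; split => //.
  by rewrite -(inj _ _ (hedges_sub He ex1) Hx fx1).
have ball x : hverts H x -> hdist_le H r o x <-> hdist_le H' r o' (f x).
  by move=> Hx; rewrite -fo; exact: dist.
exists f; split => //.
- split.
  + by move=> x [Hx ox]; split; [exact: fV|exact/ball].
  + by move=> x y; rewrite !inE => -[Hx _] [Hy _]; exact: inj.
  + move=> y [/fs[x Hx <-] oy]; exists x => //; split => //=; exact/ball.
- rewrite /= fE; apply/seteqP; split => e' /=.
    move=> [[e He <-] eB]; exists e => //; split => // x ex /=.
    apply/ball; first exact: hedges_sub He _ ex.
    by apply: eB; exact: imageP.
  move=> [e [He eB] <-]; split; first by exists e.
  by move=> _ [x ex <-] /=; apply/ball; [exact: hedges_sub He _ ex|exact: eB].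
Qed.

Lemma local_ballP (T : countType) (G : rooted_hypergraph T) r X v :
  local_ball r X v (iso_class G) <->
  rooted_iso (hball G (rh_root G) r) (rh_root G) X v.
Proof.
split=> [[G' G'X /iso_classP G'G]|GX].
  apply: rooted_iso_trans (hball_iso r (rh_rootP G) _) G'X.
  exact: rooted_iso_sym (rh_rootP _) G'G.
have GI := rrelabel_iso (pcan_inj (@choice.pickleK T)) G.
have IG := rooted_iso_sym (rh_rootP _) GI.
exists (rrelabel (pcan_inj (@choice.pickleK T)) G); last exact/iso_classP.
by apply: rooted_iso_trans GX; exact: hball_iso (rh_rootP _) IG.
Qed.

Section component.
Context {T : Type} (H : hypergraph T) (o : T).
Hypotheses (lfH : locally_finite H) (Ho : hverts H o).

Let C := induced H [set x | exists r, hdist_le H r o x].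

Let C_root : hverts C o. Proof. by split=> //; exists 0%N. Qed.

Let C_hdist r s x y : hdist_le H s o x -> hdist_le H r x y -> hdist_le C r x y.
Proof.
elim: r s x => [s x _ -> //|r IH s x ox /= [z xz zy]].
have oz : hdist_le H (s + 1) o z by apply: hdist_le_trans ox _; exists z.
exists z; last exact: IH oz zy.
case: xz => [->|[e He [ex ez]]]; [by left|right].
exists e => //; split => // t et; exists (s + 1)%N.
apply: hdist_le_trans ox _; exists t => //; right; by exists e.
Qed.

Let C_conn : hconnected C.
Proof.
move=> x y [_ [r ox]] [_ [s oy]]; exists (r + s)%N.
by apply: (C_hdist ox); apply: hdist_le_trans oy; exact: hdist_le_sym.
Qed.

Let C_lf : locally_finite C.
Proof.
split=> [x|e [He _]]; last exact: lfH.2.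
by apply: sub_finite_set (lfH.1 x) => e [[]].
Qed.

Definition component : rooted_hypergraph T :=
  RootedHypergraph C_root C_conn C_lf.

End component.

Lemma finite_locally_finite (T : finType) (H : hypergraph T) : locally_finite H.
Proof.
split => [x|e _]; last exact: finite_finset.
apply: (@sub_finite_set _ _ [set [set` A] | A in [set: {set T}]]).
  move=> e _; exists [set y | `[< e y >]]%SET => //.
  by apply/seteqP; split => y /=; rewrite inE => /asboolP.
by apply: finite_image; exact: finite_finset.
Qed.

Record random_hypergraph d (Omega : measurableType d) (N : nat) :=
  RandomHypergraph {
    rdh :> Omega -> hypergraph 'I_N;
    rdh_verts : forall w, hverts (rdh w) = [set: 'I_N];
    rdh_measurable : forall e, measurable [set w | hedges (rdh w) e] }.

Section mean_law.
Local Open Scope ereal_scope.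
Context d (Omega : measurableType d) (R : realType) (P : probability Omega R).
Context (N : nat) (H : random_hypergraph Omega N).

Lemma rdh_vert w (i : 'I_N) : hverts (H w) i.
Proof. by rewrite rdh_verts. Qed.

(* The random element [H_N(i), i]. *)
Definition component_class (i : 'I_N) (w : Omega) : Hstar :=
  iso_class (component (finite_locally_finite (H w)) (rdh_vert w i)).

Lemma component_class_eq i w w' : hedges (H w) = hedges (H w') ->
  component_class i w = component_class i w'.
Proof.
move=> EE.
have VE : hverts (H w) = hverts (H w') by rewrite !rdh_verts.
have DE r x y : hdist_le (H w) r x y = hdist_le (H w') r x y.
  by elim: r x => [//|r IH x] /=; apply/propext; split=> -[z xz zy];
    exists z; move: xz zy; rewrite /hadj ?EE ?IH.
by apply/iso_classP; apply: rooted_iso_eq;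
  rewrite /= -?EE -?VE; do ![under eq_set do under eq_exists do rewrite DE].
Qed.

Lemma measurable_component_class i : measurable_fun setT (component_class i).
Proof.
move=> _ B _; rewrite setTI.
pose code w : {set {set 'I_N}} :=
  [set A : {set 'I_N} | `[< hedges (H w) [set` A] >]]%SET.
have codeE w w' : code w = code w' -> hedges (H w) = hedges (H w').
  suff S w1 w2 : code w1 = code w2 -> hedges (H w1) `<=` hedges (H w2).
    by move=> E; apply/seteqP; split; exact: S.
  move=> E e; pose A : {set 'I_N} := [set y | `[< e y >]]%SET.
  have -> : e = [set` A].
    by apply/seteqP; split => y /=; rewrite inE => /asboolP.
  by move/setP/(_ A) : E; rewrite !inE => E /asboolP; rewrite E => /asboolP.
have mcode E : measurable [set w | code w = E].
  rewrite (_ : [set w | _] = \bigcap_(A in [set: {set 'I_N}])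
    (if A \in E then [set w | hedges (H w) [set` A]]
     else ~` [set w | hedges (H w) [set` A]])).
    apply: fin_bigcap_measurable => [|A _]; first exact: finite_finset.
    by case: ifP => _; [|apply: measurableC]; exact: rdh_measurable.
  apply/seteqP; split=> [w /= <- A _|w wE].
    by rewrite inE; case: asboolP.
  apply/setP => A; move: (wE A Logic.I); rewrite inE.
  by case: ifP => _ /= wA; apply/asboolP.
rewrite (_ : _ @^-1` _ = \bigcup_(E in [set E | exists2 w, code w = E &
    B (component_class i w)]) [set w | code w = E]).
  by apply: fin_bigcup_measurable => // ; exact: finite_finset.
apply/seteqP; split=> [w Bw|w [_ [w' <- Bw'] /= ww']].
  by exists (code w) => //; exists w.
by rewrite /preimage /= (component_class_eq i (codeE _ _ ww')).
Qed.

HB.instance Definition _ i := isMeasurableFun.Build _ _ _ _ (component_class i)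
  (measurable_component_class i).

(* mu_N = E [1/N sum_i delta_[H_N(i), i]]; the zero measure when N = 0. *)
Definition mean_law (A : set Hstar) : \bar R :=
  \int[P]_w (N%:R^-1%:E * \sum_(i < N) \d_(component_class i w) A).

Let mean_law0 : mean_law set0 = 0.
Proof.
rewrite /mean_law integral0_eq // => w _.
by rewrite big1 ?mule0 // => i _; rewrite measure0.
Qed.

Let emp_ge0 w A :
  0 <= N%:R^-1%:E * \sum_(i < N) \d_(component_class i w) A :> \bar R.
Proof. by rewrite mule_ge0 ?lee_fin ?invr_ge0 // sume_ge0. Qed.

Let mean_law_ge0 A : 0 <= mean_law A.
Proof. by apply: integral_ge0 => w _; exact: emp_ge0. Qed.

Let mean_law_sigma_additive : semi_sigma_additive mean_law.
Proof.
move=> F mF tF mUF.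
have -> : mean_law (\bigcup_n F n) = \sum_(0 <= n <oo) mean_law (F n).
  rewrite /mean_law -integral_nneseries //.
  - apply: eq_integral => w _.
    rewrite nneseriesZl; last by move=> n _; exact: sume_ge0.
    congr (_ * _); rewrite nneseries_sum //; apply: eq_bigr => i _.
    by rewrite measure_semi_bigcup.
  - move=> n; apply: emeasurable_funM => //.
    apply: emeasurable_sum => i.
    exact: measurableT_comp (measurable_fun_dirac (mF n))
      (measurable_component_class i).
apply: is_cvg_nneseries => n _ _; exact: mean_law_ge0.
Qed.

HB.instance Definition _ := isMeasure.Build _ _ _ mean_law
  mean_law0 mean_law_ge0 mean_law_sigma_additive.

End mean_law.

Section gw_hypertree.
Context (q : nat).

(* Ulam-Harris labels: rcons u (j, a) is the a-th of the q new vertices of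
   the j-th offspring hyperedge of u; the root is [::]. *)
Definition gw_label := seq (nat * 'I_q).

Context (k : gw_label -> nat).

(* k u is the number of offspring hyperedges of u, if u is in the tree. *)
Definition gw_vertices : set gw_label :=
  [set v | forall u x w, v = u ++ x :: w -> (x.1 < k u)%N].

Definition gw_edge (u : gw_label) (j : nat) : set gw_label :=
  u |` [set rcons u (j, a) | a in [set: 'I_q]].

Definition gw_edges : set (set gw_label) :=
  [set gw_edge p.1 p.2 | p in [set p | gw_vertices p.1 /\ (p.2 < k p.1)%N]].

Lemma gw_root_vertex : gw_vertices [::].
Proof. by move=> [|? ?] x w. Qed.

Lemma gw_vertices_rcons u x :
  gw_vertices (rcons u x) <-> gw_vertices u /\ (x.1 < k u)%N.
Proof.
split=> [ux|[Vu xk] u' y w].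
  split; last by apply: ux; rewrite -cats1.
  by move=> u' y w uE; apply: (ux u' y (rcons w x)); rewrite uE rcons_cat.
case: (lastP w) => [|w' z].
  by rewrite cats1 => /rcons_inj[<- <-].
by rewrite -rcons_cons -rcons_cat => /rcons_inj[uE _]; exact: Vu uE.
Qed.

Lemma gw_edges_sub e : gw_edges e -> e `<=` gw_vertices.
Proof.
move=> [[u j] /= [Vu jk] <-] _ [->//|[a _ <-]].
by apply/gw_vertices_rcons.
Qed.

Lemma gw_edges_neq0 e : gw_edges e -> e !=set0.
Proof. by move=> [[u j] _ <-]; exists u; left. Qed.

Definition gw_graph : hypergraph gw_label :=
  Hypergraph gw_edges_sub gw_edges_neq0.

Lemma gw_hadj_size x y : hadj gw_graph x y -> (size y <= (size x).+1)%N.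
Proof.
move=> [_ [[u j] /= _ <-] [ux uy]].
have sz z : gw_edge u j z -> (size u <= size z <= (size u).+1)%N.
  by case=> [->|[a _ <-]]; rewrite ?size_rcons leqnn leqnSn.
have /andP[ux' _] := sz _ ux; have /andP[_ uy'] := sz _ uy.
exact: leq_trans uy' _.
Qed.

Lemma gw_hdist_size r x y :
  hdist_le gw_graph r x y -> (size y <= size x + r)%N.
Proof.
elim: r x => [x ->|r IH x /= [z xz /IH zy]]; first by rewrite addn0.
apply: leq_trans zy _; rewrite addnS -addSn leq_add2r.
by case: xz => [->//|/gw_hadj_size].
Qed.

Lemma gw_hdist_root x :
  gw_vertices x -> hdist_le gw_graph (size x) [::] x.
Proof.
elim/last_ind: x => [//|u [j a] IH] /gw_vertices_rcons[Vu jk].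
rewrite size_rcons -addn1; apply: hdist_le_trans (IH Vu) _.
exists (rcons u (j, a)) => //; right; exists (gw_edge u j).
  by exists (u, j).
by split; [left|right; exists a].
Qed.

Lemma gw_hdistP r x :
  gw_vertices x -> hdist_le gw_graph r [::] x <-> (size x <= r)%N.
Proof.
move=> Vx; split=> [/gw_hdist_size//|xr].
have idr s y : hdist_le gw_graph s y y.
  by elim: s => // s IH; exists y => //; left.
by rewrite -(subnKC xr); apply: hdist_le_trans (gw_hdist_root Vx) (idr _ _).
Qed.

Lemma gw_conn : hconnected gw_graph.
Proof.
move=> x y Vx Vy; exists (size x + size y)%N.
apply: hdist_le_trans (gw_hdist_root Vy).
exact/hdist_le_sym/gw_hdist_root.
Qed.

Lemma gw_lf : locally_finite gw_graph.
Proof.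
split=> [x|_ [[u j] _ <-]]; last first.
  by rewrite /gw_edge finite_setU; split; [exact: finite_set1|
    apply: finite_image; exact: finite_finset].
apply: (@sub_finite_set _ _ ([set gw_edge x j | j in `I_(k x)] `|`
    [set gw_edge (take (size x).-1 x) p.1 | p in [set` x]])).
  move=> _ [[[u j] /= [_ jk] <-] [->|[a _ <-]]]; first by left; exists j.
  right; exists (j, a); first by rewrite /= mem_rcons inE eqxx.
  by rewrite size_rcons /= -cats1 take_size_cat.
by rewrite finite_setU; split; apply: finite_image => //; exact: finite_seq.
Qed.

Definition gw_hypertree : rooted_hypergraph gw_label :=
  @RootedHypergraph _ gw_graph [::] gw_root_vertex gw_conn gw_lf.

End gw_hypertree.

Lemma gw_hball_sub q (k k' : gw_label q -> nat) r :
  (forall u, (size u <= r)%N -> gw_vertices k u ->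
    gw_vertices k' u /\ k u = k' u) ->
  hverts (hball (gw_graph k) [::] r) `<=` hverts (hball (gw_graph k') [::] r) /\
  hedges (hball (gw_graph k) [::] r) `<=` hedges (hball (gw_graph k') [::] r).
Proof.
move=> kk'; split=> [u [Vu /gw_hdistP-/(_ Vu) ur]|_ [[[u j] [/= Vu jk] <-] er]].
  have [Vu' _] := kk' _ ur Vu.
  by split => //=; exact/gw_hdistP.
have sz v : gw_edge u j v -> (size v <= r)%N.
  move=> uv; apply/(gw_hdistP r (k := k)); last exact: er.
  by apply: gw_edges_sub uv; exists (u, j).
have [Vu' ku] := kk' _ (sz _ (or_introl erefl)) Vu.
have E : gw_edges k' (gw_edge u j) by exists (u, j) => //=; rewrite -ku.
by split=> // v uv /=; apply/gw_hdistP; [exact: gw_edges_sub E _ uv|exact: sz].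
Qed.

Lemma gw_local q (k : gw_label q -> nat) (U : set Hstar) :
  open U -> U (iso_class (gw_hypertree k)) ->
  exists D : seq (gw_label q), forall k', {in D, k =1 k'} ->
    U (iso_class (gw_hypertree k')).
Proof.
pose Q (V : set Hstar) := V (iso_class (gw_hypertree k)) ->
  exists D : seq (gw_label q), forall k', {in D, k =1 k'} ->
    V (iso_class (gw_hypertree k')).
have Qball V : local_balls V -> Q V.
  move=> [r [X [v [_ _ ->]]]] /local_ballP kX.
  have /finite_seqP[D DE] := hdist_le_finite r [::] (gw_lf k).
  exists D => k' kk'; apply/local_ballP; apply: rooted_iso_trans kX.
  have eqk u : gw_vertices k u -> (size u <= r)%N -> k u = k' u.
    move=> Vu ur; apply: kk'.
    suff : [set` D] u by [].
    by rewrite -DE; exact/gw_hdistP.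
  have eqV u : (size u <= r)%N -> gw_vertices k u <-> gw_vertices k' u.
    elim/last_ind: u => [_|u x IH]; first by split=> _; exact: gw_root_vertex.
    rewrite size_rcons => ur; have {}IH := IH (ltnW ur).
    split=> /gw_vertices_rcons[Vu xk]; apply/gw_vertices_rcons.
      by split; [exact/IH|rewrite -(eqk u)//; exact: ltnW].
    have Vu' := IH.2 Vu.
    by split => //; rewrite (eqk u)//; exact: ltnW.
  have [V1 E1] := gw_hball_sub
    (fun u ur Vu => conj ((eqV u ur).1 Vu) (eqk u Vu ur)).
  have eqk' u : (size u <= r)%N -> gw_vertices k' u ->
      gw_vertices k u /\ k' u = k u.
    by move=> ur /(eqV _ ur) Vu; split => //; rewrite eqk.
  have [V2 E2] := gw_hball_sub eqk'.
  by apply: rooted_iso_eq; apply/seteqP.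
move=> [B BU <-] [A BA kA].
have [F FS AE] : exists2 F : {fset set Hstar}, {subset F <= local_balls} &
  \bigcap_(V in [set` F]) V = A := BU _ BA.
have /choice[D DP] : forall V, exists D : seq (gw_label q), V \in F ->
    forall k', {in D, k =1 k'} -> V (iso_class (gw_hypertree k')).
  move=> V; have [VF|] := boolP (V \in F); last by exists [::].
  have VL : local_balls V by have := FS _ VF; rewrite inE.
  have Vk : V (iso_class (gw_hypertree k)).
    by have : A (iso_class (gw_hypertree k)) := kA; rewrite -AE; apply.
  by have [D DV] := Qball V VL Vk; exists D.
exists (flatten [seq D V | V <- F]) => k' kk'.
suff Ak' : A (iso_class (gw_hypertree k')) by exists A.
rewrite -AE => V VF; apply: (DP _ VF) => u uD; apply: kk'.
by apply/flatten_mapP; exists V.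
Qed.

Section gw_law.
Context d (Omega : measurableType d) (R : realType) (P : probability Omega R).
Context (q : nat) (K : gw_label q -> {RV P >-> nat}).

(* The random element [T, o], for T with offspring numbers (K u)_u. *)
Definition gw_class (w : Omega) : Hstar :=
  iso_class (gw_hypertree (fun u => K u w)).

Lemma measurable_gw_class : measurable_fun setT gw_class.
Proof.
apply: (@measurability _ _ _ _ _ _ (@open Hstar)) => //.
move=> _ [U oU <-]; rewrite setTI.
pose C (s : seq (gw_label q * nat)) := forall k,
  (forall p, p \in s -> k p.1 = p.2) -> U (iso_class (gw_hypertree k)).
rewrite (_ : _ @^-1` _ = \bigcup_s
    (if `[< C s >] then \bigcap_(p in [set` s]) (K p.1 @^-1` [set p.2])
     else set0)).
  apply: countable_bigcupT_measurable; first exact: countableP.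
  move=> s; case: ifP => _; last exact: measurable0.
  apply: fin_bigcap_measurable => [|p _]; first exact: finite_seq.
  by rewrite -[X in measurable X]setTI; exact: measurable_funPT.
apply/seteqP; split=> [w Uw|w [s _]]; last first.
  by case: asboolP => // Cs sw; apply: Cs => p /sw.
have [D DP] := gw_local oU Uw.
exists [seq (u, K u w) | u <- D] => //.
rewrite asboolT => [p /mapP[u _ ->]//|k kD].
by apply: DP => u uD /=; rewrite (kD (u, K u w)) //; apply/mapP; exists u.
Qed.

HB.instance Definition _ := isMeasurableFun.Build _ _ _ _ gw_class
  measurable_gw_class.

Definition gw_law : probability Hstar R := distribution P gw_class.

End gw_law.

Section independence.
Local Open Scope ereal_scope.
Context d (Omega : measurableType d) (R : realType) (P : probability Omega R).

Definition independent_events (I : eqType) (E : I -> set Omega) :=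
  forall s : seq I, uniq s ->
    P (\bigcap_(i in [set` s]) E i) = \prod_(i <- s) P (E i).

Definition independent_RVs d' (T : measurableType d') (I : eqType)
    (X : I -> {RV P >-> T}) :=
  forall B : I -> set T, (forall i, measurable (B i)) ->
    independent_events (fun i => X i @^-1` B i).

End independence.

Definition erdos_renyi d (Omega : measurableType d) (R : realType)
    (P : probability Omega R) (p N : nat) (alpha : R)
    (H : random_hypergraph Omega N) :=
  let E (A : {A : {set 'I_N} | #|A| == p}) :=
    [set w | hedges (H w) [set` val A]] in
  [/\ forall w e, hedges (H w) e ->
        exists A : {set 'I_N}, #|A| = p /\ e = [set` A],
      forall A, P (E A) = alpha%:E & independent_events P E].

Definition poisson_offspring d (Omega : measurableType d) (R : realType)
    (P : probability Omega R) (q : nat) (lambda : R)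
    (K : gw_label q -> {RV P >-> nat}) :=
  (forall u n, P (K u @^-1` [set n]) = (poisson_pmf lambda n)%:E) /\
  independent_RVs K.

Definition weak_cvg (R : realType) (mu_ : nat -> {measure set Hstar -> \bar R})
    (mu : {measure set Hstar -> \bar R}) :=
  forall f : Hstar -> R, continuous f -> bounded_fun f ->
    (\int[mu_ N]_x (f x)%:E @[N --> \oo] --> \int[mu]_x (f x)%:E)%E.

Definition local_weak_cvg (R : realType) (d : nat -> measure_display)
    (Omega : forall N, measurableType (d N))
    (P : forall N, probability (Omega N) R)
    (H : forall N, random_hypergraph (Omega N) N) (mu : probability Hstar R) :=
  weak_cvg (fun N => mean_law (P N) (H N)) mu.

(* Main.v *)
(* Proof idea.  Bounded continuous functions are approximated by layer-cake sums
   over open sets, and all laws have mass 1, so it suffices to bound the mean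
   law of each open set from below by its Galton-Watson probability.  Up to a
   small probability, an open set is a finite disjoint union of events
   prescribing the offspring numbers [k u] of all labels [u] of depth at most
   [r], and such an event has probability the product of the Poisson weights of
   the [k u].  On the Erdos-Renyi side, fix the root [i] and choose for each of
   these labels a set of [k u] vertex sets of size [p - 1], so that all chosen
   vertices are distinct and different from [i].  The event that the hyperedges
   touching the vertices of depth at most [r] are exactly those prescribed has
   probability at least alpha^e (1 - alpha)^m by independence; these events are
   disjoint, since the choice can be read off the hypergraph by induction on the
   depth; each of them forces the ball of radius [r] to be the tree; and the
   number of choices is asymptotically the product of the
   'C('C(N, p - 1), k u).  The resulting lower bound converges to the product
   of the Poisson weights. *)

Require Import Defs.
From mathcomp Require Import all_boot all_order all_algebra.
From mathcomp Require Import finmap.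
From mathcomp Require Import all_classical all_reals all_analysis.
From mathcomp Require Import measurable_realfun ring lra.

Set Implicit Arguments.
Unset Strict Implicit.
Unset Printing Implicit Defensive.
Import Order.TTheory GRing.Theory Num.Theory.
Import numFieldNormedType.Exports.
Local Open Scope classical_set_scope.
Local Open Scope ring_scope.

(** * Balls and open sets of rooted hypergraphs *)

Section balls.
Context {T : Type}.
Implicit Types (H : hypergraph T) (o x y : T).

Lemma hdist_le_refl H r x : hdist_le H r x x.
Proof. by elim: r => // r IH; exists x => //; left. Qed.

Lemma hdist_le_widen H r s x y : (r <= s)%N -> hdist_le H r x y -> hdist_le H s x y.
Proof.
by move=> rs xy; rewrite -(subnKC rs); exact: hdist_le_trans xy (hdist_le_refl _ _ _).
Qed.

Lemma hdist_le1 H x y : hadj H x y -> hdist_le H 1 x y.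
Proof. by move=> xy; exists y => //; right. Qed.

Lemma hdist_le_sub H H' r x y :
  hedges H `<=` hedges H' -> hdist_le H r x y -> hdist_le H' r x y.
Proof.
move=> HH'; elim: r x => [//|r IH x] /= [z xz /IH zy]; exists z => //.
by case: xz => [->|[e /HH' He xze]]; [left|right; exists e].
Qed.

(** A path that starts within [a] of [o] and makes [b] steps only uses hyperedges all of whose
    vertices are within [a + b] of [o], so it survives in the ball of radius [s]. *)
Lemma hdist_le_hball H o a b s x y : (a + b <= s)%N ->
  hdist_le H a o x -> hdist_le H b x y -> hdist_le (hball H o s) b x y.
Proof.
elim: b a x => [//|b IH] a x abs ox /= [z xz zy].
have oz : hdist_le H a.+1 o z.
  by rewrite -addn1; apply: hdist_le_trans ox _; exists z.
exists z; last by apply: IH oz zy; rewrite addSnnS.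
case: xz => [->|[e He [ex ez]]]; [by left|right; exists e => //].
split=> // t et /=; apply: (@hdist_le_widen _ a.+1).
  by apply: leq_trans abs; rewrite addnS ltnS leq_addr.
rewrite -addn1; apply: hdist_le_trans ox _; apply: hdist_le1; by exists e.
Qed.

Lemma hball_hball H o r s : (r <= s)%N ->
  rooted_iso (hball (hball H o s) o r) o (hball H o r) o.
Proof.
move=> rs.
have dE x : hdist_le (hball H o s) r o x <-> hdist_le H r o x.
  split=> [|ox]; first by apply: hdist_le_sub => e [].
  exact: (@hdist_le_hball _ _ 0 _ _ o).
apply: rooted_iso_eq; apply/seteqP; split => x /=.
- by move=> [[Hx _] /dE].
- by move=> [Hx ox]; do 2?split => //; [exact: hdist_le_widen ox|exact/dE].
- by move=> [[Hx _] xr]; split => // y /xr /dE.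
- move=> [Hx xr]; do 2?split => //; first by move=> y /xr; exact: hdist_le_widen.
  by move=> y /xr /dE.
Qed.

Lemma hball_root H o r : hverts H o -> hverts (hball H o r) o.
Proof. by move=> Ho; split => //; exact: hdist_le_refl. Qed.

End balls.

Lemma hball_iso_le T T' (H : hypergraph T) o (H' : hypergraph T') o' r s :
  (r <= s)%N -> hverts H o ->
  rooted_iso (hball H o s) o (hball H' o' s) o' ->
  rooted_iso (hball H o r) o (hball H' o' r) o'.
Proof.
move=> rs Ho HH'; apply: rooted_iso_trans (hball_hball H' o' rs).
apply: rooted_iso_trans (hball_iso _ (hball_root _ Ho) HH').
apply: rooted_iso_sym (hball_hball _ _ rs).
by do 2!apply: hball_root.
Qed.

(** A basic neighbourhood is an intersection of finitely many sets [local_ball]; the maximum of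
    their radii serves as [r0]. The vertex type of [G'] is arbitrary because components on ['I_N]
    will be compared with trees of labels. *)
Lemma open_local_ball (T : countType) (G : rooted_hypergraph T) (U : set Hstar) :
  open U -> U (iso_class G) ->
  exists r0, forall r, (r0 <= r)%N ->
    forall (T' : countType) (G' : rooted_hypergraph T'),
    rooted_iso (hball G' (rh_root G') r) (rh_root G')
      (hball G (rh_root G) r) (rh_root G) -> U (iso_class G').
Proof.
move=> [B BU <-] [A BA AG].
have [F FS AE] : exists2 F : {fset set Hstar}, {subset F <= local_balls} &
  \bigcap_(V in [set` F]) V = A := BU _ BA.
have /choice[f fP] : forall V, exists r0, V \in F -> forall r, (r0 <= r)%N ->
    forall (T' : countType) (G' : rooted_hypergraph T'),
    rooted_iso (hball G' (rh_root G') r) (rh_root G')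
      (hball G (rh_root G) r) (rh_root G) -> V (iso_class G').
  move=> V; have [VF|] := boolP (V \in F); last by exists 0%N.
  have : local_balls V by have := FS _ VF; rewrite inE.
  move=> [r0 [X [v [_ _ VE]]]].
  have VG : V (iso_class G).
    by have : A (iso_class G) := AG; rewrite -AE; apply.
  exists r0 => _ r rr T' G' G'G; move: VG; rewrite VE => /local_ballP GX.
  apply/local_ballP; apply: rooted_iso_trans GX.
  exact: hball_iso_le rr (rh_rootP _) G'G.
exists (\max_(V <- F) f V)%N => r rr T' G' G'G.
suff AG' : A (iso_class G') by exists A.
rewrite -AE => V VF; apply: (fP V VF r _ _ _ G'G).
apply: leq_trans rr; exact: (@leq_bigmax_seq _ (enum_fset F) xpredT f V VF).
Qed.

(** The mean law is built from components, whereas explorations are events about the whole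
    hypergraph; a ball never leaves the component of its centre. *)
Lemma hball_component T (H : hypergraph T) o (lfH : locally_finite H)
    (Ho : hverts H o) r :
  rooted_iso (hball (component lfH Ho) o r) o (hball H o r) o.
Proof.
set C := component lfH Ho.
have CE e : hedges C e <-> hedges H e /\ e `<=` [set x | exists s, hdist_le H s o x].
  by [].
have dE x : hdist_le C r o x <-> hdist_le H r o x.
  split=> [|ox]; first by apply: hdist_le_sub => e [].
  have := @hdist_le_hball _ H o 0 r r o x (leqnn _) erefl ox.
  by apply: hdist_le_sub => e [He er]; split => // y /er; exists r.
apply: rooted_iso_eq; apply/seteqP; split => x /=.
- by move=> [[Hx _] /dE].
- by move=> [Hx ox]; do 2?split => //; [by exists r|exact/dE].
- by move=> [[Hx _] xr]; split => // y /xr /dE.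
- move=> [Hx xr]; do 2?split => //; first by move=> y /xr; exists r.
  by move=> y /xr /dE.
Qed.

(** * Exploration along labels *)

Section embedding.
Context (q N : nat) (i : 'I_N).
Implicit Types (S : gw_label q -> {set {set 'I_N}}) (u v : gw_label q).

Definition nblocks S u : nat := #|S u|.

Definition block S u (j : nat) : {set 'I_N} := nth finset.set0 (enum (S u)) j.

(* [S u] is the set of the vertex sets (without [u]) of the offspring hyperedges
   of [u], put in the order of [enum]; so the vertex of a label is read off the
   value of [S] at its parent label, without recursion. *)
Definition embed S u : 'I_N :=
  if rev u is x :: v then nth i (enum (block S (rev v) x.1)) x.2 else i.

Definition tree_edge S u j : {set 'I_N} := (embed S u |: block S u j)%SET.

Definition uniform S := forall u A, A \in S u -> #|A| = q.

Definition tree_vertex S (r : nat) u :=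
  gw_vertices (nblocks S) u /\ (size u <= r)%N.

Definition embed_inj S r := forall u v,
  tree_vertex S r u -> tree_vertex S r v -> embed S u = embed S v -> u = v.

(** The second clause covers depth exactly [r] as well: an extra hyperedge there could lie inside
    the ball of radius [r] and spoil the tree. The prescribed blocks thus reach depth [r.+1], up to
    which injectivity of [embed] is required below. *)
Definition explores (H : hypergraph 'I_N) S r :=
  (forall u j, tree_vertex S r u -> (j < nblocks S u)%N ->
     hedges H [set` tree_edge S u j]) /\
  (forall u (B : {set 'I_N}), tree_vertex S r u -> embed S u \in B ->
     hedges H [set` B] ->
     exists v j, [/\ tree_vertex S r v, (j < nblocks S v)%N & B = tree_edge S v j]).

Lemma embed_rcons S u x : embed S (rcons u x) = nth i (enum (block S u x.1)) x.2.
Proof. by rewrite /embed rev_rcons revK. Qed.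

Lemma block_in S u j : (j < nblocks S u)%N -> block S u j \in S u.
Proof. by move=> ju; rewrite -mem_enum mem_nth // -cardE. Qed.

Lemma blockP S u A : A \in S u -> exists2 j, (j < nblocks S u)%N & A = block S u j.
Proof.
by rewrite -mem_enum => /(nthP finset.set0)[j ju <-]; exists j => //; rewrite /nblocks cardE.
Qed.

Lemma tree_vertex_widen S r s u : (r <= s)%N -> tree_vertex S r u -> tree_vertex S s u.
Proof. by move=> rs [? ur]; split => //; exact: leq_trans rs. Qed.

Lemma tree_vertex_rcons S r u x :
  tree_vertex S r.+1 (rcons u x) <-> tree_vertex S r u /\ (x.1 < nblocks S u)%N.
Proof.
rewrite /tree_vertex size_rcons ltnS; split=> [[/gw_vertices_rcons[? ?] ?]|[[? ?] ?]] //.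
by split => //; exact/gw_vertices_rcons.
Qed.

Section uniform.
Context (S : gw_label q -> {set {set 'I_N}}) (Su : uniform S).

Lemma card_block u j : (j < nblocks S u)%N -> #|block S u j| = q.
Proof. by move=> ju; apply: Su (block_in ju). Qed.

Lemma embed_in_block u j a : (j < nblocks S u)%N ->
  embed S (rcons u (j, a)) \in block S u j.
Proof.
by move=> ju; rewrite embed_rcons -mem_enum mem_nth // -cardE card_block.
Qed.

Lemma in_blockP u j x : (j < nblocks S u)%N -> x \in block S u j ->
  exists a, x = embed S (rcons u (j, a)).
Proof.
move=> ju; rewrite -mem_enum => /(nthP i)[a]; rewrite -cardE card_block // => aq <-.
by exists (Ordinal aq); rewrite embed_rcons.
Qed.

Lemma image_gw_edge u j : (j < nblocks S u)%N ->
  embed S @` gw_edge u j = [set` tree_edge S u j].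
Proof.
move=> ju; apply/seteqP; split => [_ [_ [->|[a _ <-]] <-]|x] /=.
- by rewrite !inE eqxx.
- by rewrite !inE embed_in_block ?orbT.
- rewrite !inE => /predU1P[->|/in_blockP-/(_ ju)[a ->]].
    by exists u => //; left.
  by exists (rcons u (j, a)) => //; right; exists a.
Qed.

Lemma tree_edgeP u j x : (j < nblocks S u)%N -> x \in tree_edge S u j ->
  exists2 v, gw_edge u j v & x = embed S v.
Proof.
move=> ju xE; have : [set` tree_edge S u j] x by [].
by rewrite -image_gw_edge // => -[v uv <-]; exists v.
Qed.

Lemma gw_edge_vertex r u j v : tree_vertex S r u -> (j < nblocks S u)%N ->
  gw_edge u j v -> tree_vertex S r.+1 v.
Proof.
move=> ur ju [->|[a _ <-]]; first exact: tree_vertex_widen ur.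
by apply/tree_vertex_rcons.
Qed.

Context (r : nat) (Sinj : embed_inj S r.+1).

Lemma embed_notin_block u j : tree_vertex S r u -> (j < nblocks S u)%N ->
  embed S u \notin block S u j.
Proof.
move=> ur ju; apply/negP => /(in_blockP ju)[a /Sinj uE].
have /(congr1 size) : u = rcons u (j, a).
  by apply: uE; [exact: tree_vertex_widen ur|exact/tree_vertex_rcons].
by rewrite size_rcons => /n_Sn.
Qed.

Lemma card_tree_edge u j : tree_vertex S r u -> (j < nblocks S u)%N ->
  #|tree_edge S u j| = q.+1.
Proof. by move=> ur ju; rewrite cardsU1 embed_notin_block // card_block. Qed.

Context (H : hypergraph 'I_N) (HT : hverts H = setT) (HS : explores H S r).

Lemma explores_dist u : tree_vertex S r.+1 u -> hdist_le H (size u) i (embed S u).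
Proof.
elim/last_ind: u => [//|u [j a] IH] ur.
have [ur' ju] := (tree_vertex_rcons _ _ _ _).1 ur.
rewrite size_rcons -addn1; apply: hdist_le_trans (IH _) _.
  exact: tree_vertex_widen ur'.
apply: hdist_le1; exists [set` tree_edge S u j]; first exact: HS.1.
by split; rewrite /= !inE ?eqxx ?embed_in_block ?orbT.
Qed.

(** The prescribed hyperedge that equals [e] contains the image of [u]; injectivity up to depth
    [r.+1] turns this into membership of the label [u] itself. *)
Lemma explores_edge e u : tree_vertex S r u -> hedges H e -> e (embed S u) ->
  exists v j, [/\ tree_vertex S r v, (j < nblocks S v)%N,
    gw_edge v j u & e = embed S @` gw_edge v j].
Proof.
move=> ur He eu; pose B := [set x | `[< e x >]]%SET.
have eB : e = [set` B].
  by apply/seteqP; split => x /=; rewrite inE => /asboolP.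
have uB : embed S u \in B by rewrite inE; exact/asboolP.
rewrite eB in He; have [v [j [vr jv BE]]] := HS.2 _ _ ur uB He.
exists v, j; split => //; last by rewrite eB BE image_gw_edge.
move: uB; rewrite BE => /(tree_edgeP jv)[u' vu' /Sinj ->] //.
  exact: tree_vertex_widen ur.
exact: gw_edge_vertex vu'.
Qed.

(** A path of [H] is lifted to labels one hyperedge at a time. A hyperedge at the image of [v] is
    issued by [v] or by its parent, so each step increases the depth by at most one. *)
Lemma explores_reach s v y : (size v + s <= r)%N -> gw_vertices (nblocks S) v ->
  hdist_le H s (embed S v) y ->
  exists u, [/\ gw_vertices (nblocks S) u, (size u <= size v + s)%N & y = embed S u].
Proof.
elim: s v => [|s IH] v vs Vv /=; first by move=> <-; exists v; rewrite addn0.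
move=> [z vz zy].
suff [u [Vu uv zu]] : exists u, [/\ gw_vertices (nblocks S) u, (size u <= (size v).+1)%N &
    z = embed S u].
  have us : (size u + s <= size v + s.+1)%N by rewrite -addSnnS leq_add2r.
  rewrite zu in zy; have [|w [Vw wu yw]] := IH u _ Vu zy; first exact: leq_trans vs.
  by exists w; split => //; exact: leq_trans us.
case: vz => [<-|[e He [ev ez]]]; first by exists v.
have vr : tree_vertex S r v by split => //; apply: leq_trans vs; exact: leq_addr.
have [w [j [[Vw wr] jw wv eE]]] := explores_edge vr He ev.
move: ez; rewrite eE => -[u wu <-]; exists u; split => //.
  apply: (gw_edges_sub _ wu); by exists (w, j).
have wv' : (size w <= size v)%N.
  by case: wv => [->//|[a _ <-]]; rewrite size_rcons.
by case: wu => [->|[a _ <-]]; rewrite ?size_rcons // (leq_trans wv').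
Qed.

Lemma explores_hball :
  rooted_iso (hball H i r) i (hball (gw_graph (nblocks S)) [::] r) [::].
Proof.
have Vball u : hverts (hball (gw_graph (nblocks S)) [::] r) u <-> tree_vertex S r u.
  by split=> [[Vu /gw_hdistP]|[Vu ur]]; [move=> /(_ Vu)|split => //; exact/gw_hdistP].
apply: rooted_iso_sym; first by apply/Vball; split => //; exact: gw_root_vertex.
exists (embed S); split => //.
- split.
  + move=> u /Vball ur; split; first by rewrite HT.
    apply: hdist_le_widen (ur.2) _; apply: explores_dist.
    exact: tree_vertex_widen ur.
  + move=> u v; rewrite !inE => /Vball ur /Vball vr; apply: Sinj.
      exact: tree_vertex_widen ur.
    exact: tree_vertex_widen vr.
  + move=> y [_ iy]; have [|u [Vu ur ->]] := explores_reach _ (gw_root_vertex _) iy => //.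
    by exists u => //; exact/Vball.
- apply/seteqP; split => [e [He er]|_ [_ [[[v j] /= [Vv jv] <-] er] <-]].
    have [x ex] := hedges_neq0 He.
    have [|u [Vu ur xu]] := explores_reach _ (gw_root_vertex _) (er _ ex) => //.
    rewrite xu in ex; have [//|v [j [vr jv vu eE]]] := explores_edge _ He ex.
    exists (gw_edge v j) => //; split; first by exists (v, j) => //; split; [exact: vr.1|].
    move=> w vw /=.
    have wr : tree_vertex S r.+1 w by exact: gw_edge_vertex vw.
    have ew : e (embed S w) by rewrite eE; exact: imageP.
    (* A priori [w] may have depth [r.+1]. Its image lies in the ball, hence is also the image of
       some [w'] of depth at most [r], and injectivity identifies the two. *)
    have [|w' [Vw' w'r ww']] := explores_reach _ (gw_root_vertex _) (er _ ew) => //.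
    have -> : w = w' by apply: Sinj => //; split => //; exact: leqW.
    exact/gw_hdistP.
  have vr : tree_vertex S r v.
    by apply/Vball; split => //; apply: er; left.
  split; first by rewrite image_gw_edge //; exact: HS.1.
  move=> _ [w vw <-] /=.
  have wr : tree_vertex S r w.
    apply/Vball; split; last exact: er.
    exact: (gw_edge_vertex vr jv vw).1.
  apply: hdist_le_widen wr.2 _; apply: explores_dist; exact: tree_vertex_widen wr.
Qed.

End uniform.

End embedding.

(** * Uniqueness of the exploration of a given hypergraph *)

Section exploration_unique.
Context (q N : nat) (i : 'I_N) (H : hypergraph 'I_N) (r : nat).
Implicit Types (S : gw_label q -> {set {set 'I_N}}) (u v : gw_label q).

(** The hyperedges at [u] are its offspring hyperedges and the one shared with its parent. So [S u]
    can be recovered from [H] once the image of [u] and its parent hyperedge are known. *)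
Lemma explores_blocks S u A :
  uniform S -> embed_inj i S r.+1 -> explores i H S r -> tree_vertex S r u ->
  A \in S u <-> [/\ #|A| = q, embed i S u \notin A,
    hedges H [set` (embed i S u |: A)%SET] &
    forall v x, u = rcons v x -> (embed i S u |: A)%SET <> tree_edge i S v x.1].
Proof.
move=> Su Sinj HS ur; have ur' := tree_vertex_widen (leqnSn r) ur; split.
  move=> AS; have [j ju AE] := blockP AS; split.
  - exact: Su AS.
  - by rewrite AE; exact: (embed_notin_block Su Sinj).
  - by rewrite AE; exact: HS.1.
  - move=> v x uE; have [vr xv] : tree_vertex S r v /\ (x.1 < nblocks S v)%N.
      by apply/tree_vertex_rcons; rewrite -uE.
    have vr' := tree_vertex_widen (leqnSn r) vr.
    (* The parent [v] belongs to its own hyperedge, so it would have to be [u] or a child of [u];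
       the lengths of the labels exclude both. *)
    move/setP/(_ (embed i S v)); rewrite !inE eqxx /= => /predU1P[/Sinj|].
      by move=> /(_ vr' ur')/(congr1 size); rewrite uE size_rcons => /n_Sn.
    rewrite AE => /(in_blockP i Su ju)[a /Sinj vE].
    have /vE : tree_vertex S r.+1 (rcons u (j, a)) by apply/tree_vertex_rcons.
    move=> /(_ vr')/(congr1 size); rewrite uE !size_rcons => /eqP.
    by rewrite -[X in X == _]addn0 -addn2 eqn_add2l.
move=> [Aq uA AH uNp].
have [v [j [vr jv AE]]] := HS.2 _ (embed i S u |: A)%SET ur (setU11 _ _) AH.
have vr' := tree_vertex_widen (leqnSn r) vr.
have := setU11 (embed i S u) A; rewrite AE => /setU1P[/Sinj uv|].
  suff -> : A = block S u j by rewrite uv //; exact: block_in.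
  have <- := setU1K uA; rewrite AE /tree_edge -uv // setU1K //.
  by apply: (embed_notin_block Su Sinj) => //; rewrite uv.
(* In the remaining case [u] is a child of [v], and the hyperedge is the excluded parent
   hyperedge. *)
move=> /(in_blockP i Su jv)[a /Sinj uE].
by case: (uNp v (j, a)) => //; apply: uE => //; exact/tree_vertex_rcons.
Qed.

(** Induction on the label: the value at the parent fixes both the image of the child and the
    hyperedge joining them, after which [explores_blocks] determines the value at the child. *)
Lemma explores_unique S S' : uniform S -> uniform S' ->
  embed_inj i S r.+1 -> embed_inj i S' r.+1 ->
  explores i H S r -> explores i H S' r ->
  forall u, tree_vertex S r u ->
    [/\ tree_vertex S' r u, embed i S u = embed i S' u & S u = S' u].
Proof.
move=> Su Su' Sinj Sinj' HS HS'.
have blocksE u : tree_vertex S r u -> tree_vertex S' r u ->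
    embed i S u = embed i S' u ->
    (forall v x, u = rcons v x -> tree_edge i S v x.1 = tree_edge i S' v x.1) ->
    S u = S' u.
  move=> ur ur' uE pE; apply/setP => A.
  have SA := explores_blocks A Su Sinj HS ur.
  have SA' := explores_blocks A Su' Sinj' HS' ur'.
  apply/idP/idP => [/SA[]|/SA'[]] Aq uA AH Ap; [apply/SA'|apply/SA].
    by rewrite -uE; split => // v x uvx; rewrite -pE //; exact: Ap.
  by rewrite uE; split => // v x uvx; rewrite pE //; exact: Ap.
elim/last_ind => [|u x IH].
  move=> ur; have ur' : tree_vertex S' r [::] by split => //; exact: gw_root_vertex.
  by split => //; apply: blocksE => // v x /(congr1 size); rewrite size_rcons.
move=> uxr; have ur : tree_vertex S r u.
  exact: ((tree_vertex_rcons _ _ _ _).1 (tree_vertex_widen (leqnSn r) uxr)).1.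
have [ur' uE SE] := IH ur.
have xS : (x.1 < nblocks S u)%N by have [] := (gw_vertices_rcons _ _ _).1 uxr.1.
have uxr' : tree_vertex S' r (rcons u x).
  split; last exact: uxr.2.
  apply/gw_vertices_rcons; split; first exact: ur'.1.
  by rewrite /nblocks -SE.
have bE j : block S u j = block S' u j by rewrite /block SE.
have uxE : embed i S (rcons u x) = embed i S' (rcons u x) by rewrite !embed_rcons bE.
split => //; apply: blocksE => // v y /rcons_inj[<- <-].
by rewrite /tree_edge uE bE.
Qed.

End exploration_unique.

(** * Counting the explorations of a given shape *)

Section gw_labels.
Context (q : nat).
Implicit Types (k : gw_label q -> nat) (u : gw_label q).

Definition gw_labels k r : {fset gw_label q} :=
  fset_set [set u | gw_vertices k u /\ (size u <= r)%N].

Lemma in_gw_labels k r u : u \in gw_labels k r <-> gw_vertices k u /\ (size u <= r)%N.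
Proof.
rewrite in_fset_set; first by rewrite inE.
apply: sub_finite_set (hdist_le_finite r [::] (gw_lf k)) => v /= [Vv vr].
exact/gw_hdistP.
Qed.

(** Whether a label is a vertex depends only on [k] at its proper prefixes; hence agreement down to
    depth [r] decides membership down to depth [r.+1]. *)
Lemma gw_vertices_eq k k' r :
  (forall u, gw_vertices k u -> (size u <= r)%N -> k u = k' u) ->
  forall u, (size u <= r.+1)%N -> gw_vertices k u <-> gw_vertices k' u.
Proof.
move=> kk'; elim/last_ind => [_|u x IH]; first by split=> _; exact: gw_root_vertex.
rewrite size_rcons ltnS => ur; have {}IH := IH (leqW ur).
split=> /gw_vertices_rcons[Vu xk]; apply/gw_vertices_rcons.
  by split; [exact/IH|rewrite -kk'].
have Vu' := IH.2 Vu; by split => //; rewrite kk'.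
Qed.

Lemma gw_hball_eq k k' r :
  (forall u, u \in gw_labels k r -> k u = k' u) ->
  rooted_iso (hball (gw_graph k) [::] r) [::] (hball (gw_graph k') [::] r) [::].
Proof.
move=> kk'; have {}kk' u : gw_vertices k u -> (size u <= r)%N -> k u = k' u.
  by move=> Vu ur; apply: kk'; apply/in_gw_labels.
have VE u : (size u <= r)%N -> gw_vertices k u <-> gw_vertices k' u.
  by move=> ur; exact: (gw_vertices_eq kk' (leqW ur)).
have [V1 E1] := gw_hball_sub (fun u (ur : (size u <= r)%N) Vu =>
  conj ((VE u ur).1 Vu) (kk' u Vu ur)).
have [V2 E2] := gw_hball_sub (fun u (ur : (size u <= r)%N) Vu' =>
  conj ((VE u ur).2 Vu') (esym (kk' u ((VE u ur).2 Vu') ur))).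
by apply: rooted_iso_eq; apply/seteqP.
Qed.

End gw_labels.

Section block_families.
Context (q N : nat) (i : 'I_N) (k : gw_label q -> nat) (r : nat).
Local Notation D := (gw_labels k r).
Local Notation data := {ffun D -> {set {set 'I_N}}}.
Implicit Types s : data.

(** Choices are finite functions on [D] so that they can be counted. With the empty set elsewhere,
    labels outside [D] have no offspring. *)
Definition extend s (u : gw_label q) : {set {set 'I_N}} :=
  if insub u is Some x then s x else finset.set0.

Definition block_choices n : {set {set {set 'I_N}}} :=
  [set X : {set {set 'I_N}} | (X \subset [set A : {set 'I_N} | #|A| == q])
     & (#|X| == n)]%SET.

Definition block_families : pred data := family (fun x : D => mem (block_choices (k (val x)))).

Local Notation C := {x : D & ('I_(k (val x)) * 'I_q)%type}.

(** As [c] varies, these are the non-root labels of depth at most [r.+1]. *)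
Definition child_label (c : C) : gw_label q :=
  rcons (val (tag c)) (val (tagged c).1, (tagged c).2).

Definition child_embed s : {ffun C -> 'I_N} :=
  [ffun c => embed i (extend s) (child_label c)].

Definition injective_families : {set data} :=
  [set s | [&& s \in block_families, injectiveb (child_embed s) &
     [forall c, child_embed s c != i]]]%SET.

Lemma extend_val s (x : D) : extend s (val x) = s x.
Proof. by rewrite /extend valK. Qed.

Lemma block_familiesP s :
  reflect (forall x, (#|s x| = k (val x)) /\ (forall A, A \in s x -> #|A| = q))
    (s \in block_families).
Proof.
apply: (iffP familyP) => sP x; have := sP x; rewrite inE.
  move=> /andP[/fintype.subsetP sx /eqP ->]; split => // A /sx; rewrite inE => /eqP //.
move=> [-> sx]; rewrite eqxx andbT; apply/fintype.subsetP => A /sx Aq.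
by rewrite inE Aq.
Qed.

Section family.
Context (s : data) (sF : s \in block_families).

Lemma extend_uniform : uniform (extend s).
Proof.
move=> u A; rewrite /extend; case: insubP => [x _ _|_]; last by rewrite inE.
exact: (block_familiesP _ sF x).2.
Qed.

Lemma nblocks_extend u : gw_vertices k u -> (size u <= r)%N ->
  k u = nblocks (extend s) u.
Proof.
move=> Vu ur; have uD : u \in D by exact/in_gw_labels.
rewrite /nblocks -[u]/(val (FSetSub uD)) extend_val.
by rewrite (block_familiesP _ sF _).1.
Qed.

Lemma tree_vertex_extend u : tree_vertex (extend s) r u <-> u \in D.
Proof.
split=> [[Vu ur]|/in_gw_labels[Vu ur]].
  by apply/in_gw_labels; split => //; apply/(gw_vertices_eq nblocks_extend) => //; exact: leqW.
by split => //; apply/(gw_vertices_eq nblocks_extend) => //; exact: leqW.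
Qed.

Lemma child_labelP u : tree_vertex (extend s) r.+1 u ->
  u = [::] \/ exists c, u = child_label c.
Proof.
elim/last_ind: u => [|u [j a] _]; [by left|right].
have [/tree_vertex_extend uD ju] := (tree_vertex_rcons _ _ _ _).1 H.
have ju' : (j < k (val (FSetSub uD)))%N.
  by have [? ?] := (in_gw_labels _ _ _).1 uD; rewrite nblocks_extend.
by exists (@Tagged _ (FSetSub uD) (fun x : D => ('I_(k (val x)) * 'I_q)%type)
  (Ordinal ju', a)).
Qed.

End family.

Lemma injective_families_inj s : s \in injective_families ->
  embed_inj i (extend s) r.+1.
Proof.
rewrite inE => /and3P[sF /injectiveP sI /forallP si] u v ur vr.
have sE c : embed i (extend s) (child_label c) = child_embed s c by rewrite ffunE.
have si' c : embed i (extend s) [::] != embed i (extend s) (child_label c).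
  by rewrite sE eq_sym; exact: si.
have [->|[c ->]] := child_labelP sF ur; have [->|[c' ->]] := child_labelP sF vr => //.
- by move/eqP; rewrite (negbTE (si' _)).
- by move/esym/eqP; rewrite (negbTE (si' _)).
- by rewrite !sE => /sI ->.
Qed.

(** A block is the set of the images of its [q] labels, so these images determine the family.
    Families that fail injectivity are therefore no more numerous than the maps that fail it. *)
Lemma child_embed_inj : {in block_families &, injective child_embed}.
Proof.
suff sub s s' : s \in block_families -> s' \in block_families ->
    child_embed s = child_embed s' -> forall x, s x \subset s' x.
  move=> s s' sF s'F ss'; apply/ffunP => x; apply/eqP.
  by rewrite finset.eqEsubset !sub //; apply/esym.
move=> sF s'F ss' x; apply/fintype.subsetP => A; rewrite -extend_val => /blockP[j].
have [Vx xr] := (in_gw_labels _ _ _).1 (valP x).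
rewrite -(nblocks_extend sF) // => jx ->.
suff -> : block (extend s) (val x) j = block (extend s') (val x) j.
  by rewrite -extend_val block_in // -(nblocks_extend s'F).
have embE a : embed i (extend s) (rcons (val x) (j, a)) =
    embed i (extend s') (rcons (val x) (j, a)).
  have /ffunP/(_ (@Tagged _ x (fun x : D => ('I_(k (val x)) * 'I_q)%type)
    (Ordinal jx, a))) := ss'.
  by rewrite !ffunE.
have jxs : (j < nblocks (extend s) (val x))%N by rewrite -(nblocks_extend sF).
have jxs' : (j < nblocks (extend s') (val x))%N by rewrite -(nblocks_extend s'F).
apply/setP => y; apply/idP/idP => /(in_blockP i (extend_uniform _)).
  by move=> /(_ sF jxs)[a ->]; rewrite embE embed_in_block //; exact: extend_uniform.
by move=> /(_ s'F jxs')[a ->]; rewrite -embE embed_in_block //; exact: extend_uniform.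
Qed.

Lemma card_child_labels : #|{: C}| = (q * \sum_(x : D) k (val x))%N.
Proof.
rewrite card_tagged sumnE big_map big_enum /= big_distrr /=.
by apply: eq_bigr => x _; rewrite card_prod !card_ord mulnC.
Qed.

Lemma card_block_families :
  #|block_families| = (\prod_(x : D) 'C('C(N, q), k (val x)))%N.
Proof.
rewrite card_family foldrE big_map big_enum /=; apply: eq_bigr => x _.
by rewrite cards_draws card_draws card_ord.
Qed.

(* The correction is the number of maps from the non-root labels to 'I_N that are
   not injective or take the value [i]. *)
Lemma card_injective_families :
  (\prod_(x : D) 'C('C(N, q), k (val x)) <=
   #|injective_families| + (N ^ (q * \sum_(x : D) k (val x))
     - (N.-1) ^_ (q * \sum_(x : D) k (val x))))%N.
Proof.
rewrite -card_block_families -card_child_labels.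
pose I := [set g : {ffun C -> 'I_N} in ffun_on (predC1 i) | injectiveb g]%SET.
have <- : #|~: I| = (N ^ #|{: C}| - N.-1 ^_ #|{: C}|)%N.
  have : (#|I| + #|~: I|)%N = (N ^ #|{: C}|)%N by rewrite cardsC card_ffun card_ord.
  by rewrite card_inj_ffuns_on cardC1 card_ord => <-; rewrite addKn.
rewrite -(cardsE block_families).
(* The families are split into the injective ones and the others; [child_embed] sends the others
   injectively into the complement of [I]. *)
rewrite -(cardsID injective_families [set s in block_families]%SET) leq_add ?subset_leq_card ?finset.subsetIr //.
rewrite -(card_in_imset (f := child_embed)); last first.
  move=> s s' /finset.setDP[+ _] /finset.setDP[+ _]; rewrite !inE; exact: child_embed_inj.
apply/subset_leq_card/fintype.subsetP => _ /imsetP[s /finset.setDP[+ sI] ->].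
rewrite inE => sF; rewrite !inE; apply: contra sI => /andP[/ffun_onP gi gI].
by rewrite inE sF gI; apply/forallP => c; exact: gi.
Qed.

End block_families.

Arguments block_families {q N} k r _.

(** * Probability of an exploration *)

(** Induction on the complemented events: imposing the complement of [E x] subtracts the probability
    with [x] added to [s], and [a ^+ n - a ^+ n.+1] is [a ^+ n * (1 - a)]. The list [s] is
    generalized because [x] joins it. *)
Lemma independent_events_setC d (Omega : measurableType d) (R : realType)
    (P : probability Omega R) (I : eqType) (E : I -> set Omega) (a : R) :
  (forall x, measurable (E x)) -> (forall x, P (E x) = a%:E) ->
  independent_events P E -> forall s t, uniq (s ++ t) ->
  P (\bigcap_(x in [set` s]) E x `&` \bigcap_(x in [set` t]) ~` E x) =
    (a ^+ size s * (1 - a) ^+ size t)%:E.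
Proof.
move=> mE PE indE s t; elim: t s => [|x t IH] s.
  rewrite cats0 => us; rewrite expr0 mulr1.
  rewrite (_ : [set` [::]] = set0); last by apply/seteqP; split.
  rewrite bigcap_set0 setIT indE //; under eq_bigr do rewrite PE.
  by rewrite prodEFin big_const_seq count_predT iter_mulr_1.
move=> ust; have usxt : uniq ((x :: s) ++ t).
  by move: ust; rewrite -cat1s uniq_catCA.
have ust' : uniq (s ++ t) by case/andP: usxt.
have mI (u : seq I) : measurable (\bigcap_(y in [set` u]) E y).
  by apply: fin_bigcap_measurable => [|y _]; [exact: finite_seq|exact: mE].
have mIC (u : seq I) : measurable (\bigcap_(y in [set` u]) ~` E y).
  by apply: fin_bigcap_measurable => [|y _]; [exact: finite_seq|exact/measurableC/mE].
set A := \bigcap_(y in [set` s]) E y `&` \bigcap_(y in [set` t]) ~` E y.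
set B := \bigcap_(y in [set` x :: s]) E y `&` \bigcap_(y in [set` t]) ~` E y.
have AB : A `&` B = B.
  apply/seteqP; split => [w []//|w [wE wC]]; split => //; split => // y ys.
  by apply: wE; rewrite /= inE; apply/orP; right.
rewrite (_ : _ `&` _ = A `\` B).
  have -> : P (A `\` B) = (P A - P B)%E.
    rewrite measureD ?AB //; [exact: measurableI|exact: measurableI|].
    by rewrite (le_lt_trans (probability_le1 _ _)) ?ltry //; exact: measurableI.
  have -> : P A = (a ^+ size s * (1 - a) ^+ size t)%:E := IH s ust'.
  have -> : P B = (a ^+ (size s).+1 * (1 - a) ^+ size t)%:E := IH (x :: s) usxt.
  by rewrite -EFinB /= !exprS; congr (_%:E); ring.
apply/seteqP; split => w.
  move=> [wE wC]; have wx : ~ E x w by apply: wC; rewrite /= inE eqxx.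
  split; first by split => // y yt; apply: wC; rewrite /= inE; apply/orP; right.
  by move=> [/(_ x)]; rewrite /= inE eqxx => /(_ erefl).
move=> [[wE wC] nB]; split => // y; rewrite /= inE => /predU1P[->|]; last exact: wC.
move=> wx; apply: nB; split => // z; rewrite /= inE => /predU1P[->//|]; exact: wE.
Qed.

Lemma card_bigcup_le (I T : finType) (F : I -> {set T}) :
  (#|(\bigcup_x F x)%SET| <= \sum_x #|F x|)%N.
Proof.
elim/big_ind2: _ => [|n A m B nA mB|//]; first by rewrite cards0.
by apply: leq_trans (leq_add nA mB); rewrite cardsU leq_subr.
Qed.

Section explore_event.
Local Open Scope ereal_scope.
Context d (Omega : measurableType d) (R : realType) (P : probability Omega R).
Context (q N : nat) (i : 'I_N) (alpha : R) (H : random_hypergraph Omega N).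
Hypotheses (alpha01 : (0 < alpha < 1)%R) (HER : erdos_renyi P q.+1 alpha H).
Context (k : gw_label q -> nat) (r : nat) (s : {ffun gw_labels k r -> {set {set 'I_N}}}).
Hypothesis sI : s \in injective_families i k r.
Local Notation D := (gw_labels k r).

Definition explore_event : set Omega := [set w | explores i (H w) (extend s) r].

Definition tree_edges : {set {set 'I_N}} :=
  (\bigcup_(x : D) [set tree_edge i (extend s) (val x) j | j : 'I_(k (val x))])%SET.

Definition touched (B : {set 'I_N}) :=
  [exists x : D, embed i (extend s) (val x) \in B].

Let sF : s \in block_families k r. Proof. by move: sI; rewrite inE => /andP[]. Qed.

Lemma tree_edgesP B : B \in tree_edges <->
  exists u j, [/\ tree_vertex (extend s) r u, (j < nblocks (extend s) u)%N &
    B = tree_edge i (extend s) u j].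
Proof.
split.
  move=> /bigcupP[x _ /imsetP[j _ ->]]; exists (val x), j.
  have xr := (tree_vertex_extend sF _).2 (valP x); split => //.
  have [Vx xr'] := (in_gw_labels _ _ _).1 (valP x).
  by rewrite -(nblocks_extend sF).
move=> [u [j [/(tree_vertex_extend sF) uD ju ->]]].
have [Vu ur] := (in_gw_labels _ _ _).1 uD.
rewrite -(nblocks_extend sF) // in ju.
by apply/bigcupP; exists (FSetSub uD) => //; apply/imsetP; exists (Ordinal ju).
Qed.

(** One condition for each vertex set [B], concerning only whether [B] is a hyperedge: this yields
    measurability as well as the comparison with independent events. *)
Lemma explore_eventE : explore_event = [set w | forall B : {set 'I_N},
  (B \in tree_edges -> hedges (H w) [set` B]) /\
  (B \notin tree_edges -> touched B -> ~ hedges (H w) [set` B])].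
Proof.
apply/seteqP; split => w /=.
  move=> [w1 w2] B; split; first by move=> /tree_edgesP[u [j [ur ju ->]]]; exact: w1.
  move=> /negP BT /existsP[x xB] HB; apply: BT; apply/tree_edgesP.
  exact: w2 ((tree_vertex_extend sF _).2 (valP x)) xB HB.
move=> wB; split=> [u j ur ju|u B /(tree_vertex_extend sF) uD uB HB].
  by apply: (wB _).1; apply/tree_edgesP; exists u, j.
have [BT|BT] := boolP (B \in tree_edges); first exact/tree_edgesP.
by case: ((wB B).2 BT _ HB); apply/existsP; exists (FSetSub uD).
Qed.

Lemma measurable_explore_event : measurable explore_event.
Proof.
rewrite explore_eventE; pose G (B : {set 'I_N}) := [set w |
  (B \in tree_edges -> hedges (H w) [set` B]) /\
  (B \notin tree_edges -> touched B -> ~ hedges (H w) [set` B])].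
rewrite (_ : [set w | _] = \bigcap_(B in [set: {set 'I_N}]) G B); last first.
  by apply/seteqP; split => w wG B; [move=> _|]; exact: wG.
apply: fin_bigcap_measurable => [|B _]; first exact: finite_finset.
rewrite /G; case: (B \in tree_edges) => /=; last case: (touched B).
- rewrite (_ : [set _ | _] = [set w | hedges (H w) [set` B]]); first exact: rdh_measurable.
  by apply/seteqP; split => w /=; [case=> + _; exact|].
- rewrite (_ : [set _ | _] = ~` [set w | hedges (H w) [set` B]]).
    exact/measurableC/rdh_measurable.
  by apply/seteqP; split => w /=; [case=> _; exact|].
- rewrite (_ : [set _ | _] = setT); first exact: measurableT.
  by apply/seteqP; split => w.
Qed.

Lemma card_tree_edges : (#|tree_edges| <= \sum_(x : D) k (val x))%N.
Proof.
apply: leq_trans (card_bigcup_le _) _; apply: leq_sum => x _.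
by apply: leq_trans (leq_imset_card _ _) _; rewrite card_ord.
Qed.

(** Deleting [y] is injective on sets containing [y]. The slightly larger ['C(N, q)] in place of
    ['C(N.-1, q)] has the same asymptotics. *)
Lemma card_sets_containing (y : 'I_N) :
  (#|[set B : {set 'I_N} | #|B| == q.+1 & y \in B]%SET| <= 'C(N, q))%N.
Proof.
rewrite -[X in 'C(X, q)]card_ord -card_draws.
rewrite -(card_in_imset (f := fun B : {set 'I_N} => (B :\ y)%SET)); last first.
  move=> A B; rewrite !inE => /andP[_ yA] /andP[_ yB] AB.
  by rewrite -(finset.setD1K yA) -(finset.setD1K yB) AB.
apply/subset_leq_card/fintype.subsetP => _ /imsetP[B + ->]; rewrite !inE => /andP[+ yB].
by rewrite (cardsD1 y B) yB.
Qed.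

Lemma card_touched :
  (#|[set B : {set 'I_N} | (#|B| == q.+1) && touched B]%SET| <= #|` D| * 'C(N, q))%N.
Proof.
have -> : (#|` D| * 'C(N, q) = \sum_(x : D) 'C(N, q))%N.
  by rewrite sum_nat_const cardfE.
apply: leq_trans _ (leq_sum _ (fun x _ => card_sets_containing (embed i (extend s) (val x)))).
apply: leq_trans _ (card_bigcup_le _); apply/subset_leq_card/fintype.subsetP => B.
rewrite !inE => /andP[Bq /existsP[x xB]]; apply/bigcupP; exists x => //.
by rewrite inE Bq.
Qed.

Lemma explore_event_ge :
  (alpha ^+ (\sum_(x : D) k (val x)) * (1 - alpha) ^+ (#|` D| * 'C(N, q)))%:E
    <= P explore_event.
Proof.
have [Hp Pa indE] := HER; pose I : finType := {A : {set 'I_N} | #|A| == q.+1}.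
pose E (A : I) := [set w | hedges (H w) [set` val A]].
(* [s1] lists the hyperedges that must be present and [s2] those that must be absent, among the sets
   of [q.+1] vertices, to which independence applies. *)
pose s1 := [seq A <- enum I | val A \in tree_edges].
pose s2 := [seq A <- enum I | (val A \notin tree_edges) && touched (val A)].
have size_le (t : seq I) (B : {set {set 'I_N}}) : uniq t ->
    (forall A, A \in t -> val A \in B) -> (size t <= #|B|)%N.
  move=> ut tB; have utv : uniq (map (val : I -> {set 'I_N}) t).
    by rewrite map_inj_uniq //; exact: val_inj.
  rewrite -(size_map (val : I -> {set 'I_N})) -(card_uniqP utv); apply/subset_leq_card/fintype.subsetP => _ /mapP[A At ->].
  exact: tB.
have s1e : (size s1 <= \sum_(x : D) k (val x))%N.
  apply: leq_trans card_tree_edges; apply: size_le; first by rewrite filter_uniq ?enum_uniq.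
  by move=> A; rewrite mem_filter => /andP[].
have s2e : (size s2 <= #|` D| * 'C(N, q))%N.
  apply: leq_trans card_touched; apply: size_le; first by rewrite filter_uniq ?enum_uniq.
  by move=> A; rewrite mem_filter inE => /andP[/andP[_ ->] _]; rewrite (valP A).
have us : uniq (s1 ++ s2).
  rewrite cat_uniq; apply/and3P; split; try by rewrite filter_uniq ?enum_uniq.
  apply/hasPn => A.
  by rewrite !mem_filter => /andP[/andP[/negbTE -> _] _].
have mE A : measurable (E A) by exact: rdh_measurable.
(* The two sizes are only bounded from above; since [alpha] and [1 - alpha] lie in the unit
   interval, larger exponents lower the product. *)
apply: (@le_trans _ _ (alpha ^+ size s1 * (1 - alpha) ^+ size s2)%:E).
  rewrite lee_fin; have [a0 a1] := andP alpha01.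
  by apply: ler_pM; rewrite ?exprn_ge0 ?subr_ge0 ?(ltW a0) ?(ltW a1) //;
    apply: ler_wiXn2l; rewrite ?subr_ge0 ?(ltW a0) ?(ltW a1) // gerBl ltW.
rewrite -(independent_events_setC mE (Pa : forall A, P (E A) = alpha%:E) indE us); apply: le_measure.
- rewrite inE; apply: measurableI; apply: fin_bigcap_measurable.
  + exact: finite_seq.
  + by move=> A _; exact: mE.
  + exact: finite_seq.
  + by move=> A _; exact/measurableC/mE.
- by rewrite inE; exact: measurable_explore_event.
move=> w [w1 w2]; rewrite explore_eventE => B; split => [BT|BT Bt HB].
  have Bq : #|B| == q.+1.
    have [u [j [ur ju ->]]] := (tree_edgesP _).1 BT.
    by rewrite (card_tree_edge (extend_uniform sF) (injective_families_inj sI)).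
  apply: (w1 (exist _ B Bq : I)).
  by rewrite /= mem_filter BT mem_enum.
(* Here [B] is assumed to be a hyperedge, and the model has hyperedges of [q.+1] vertices only. *)
have Bq : #|B| == q.+1.
  have [A [Aq BA]] := Hp _ _ HB; suff -> : B = A by exact/eqP.
  apply/setP => x; have /= BAx : [set` B] x = [set` A] x by rewrite BA.
  by apply/idP/idP; rewrite BAx.
apply: (w2 (exist _ B Bq : I)) => //.
by rewrite /= mem_filter BT Bt mem_enum.
Qed.

End explore_event.

Lemma sum_measure_le d (T : measurableType d) (R : realType)
    (mu : {measure set T -> \bar R}) (I : eqType) (s : seq I) (F : I -> set T) (B : set T) :
  uniq s -> measurable B -> (forall x, x \in s -> measurable (F x) /\ F x `<=` B) ->
  (forall x y, x \in s -> y \in s -> F x `&` F y !=set0 -> x = y) ->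
  (\sum_(x <- s) mu (F x) <= mu B)%E.
Proof.
elim: s B => [|x s IH] B; first by rewrite big_nil.
move=> /= /andP[xs us] mB FB Fd; rewrite big_cons.
have [mFx FxB] := FB x (mem_head _ _).
rewrite -(setDKU FxB) measureU //; [|exact: measurableD|]; last first.
  by rewrite setDE -setIA setICl setI0.
rewrite addeC leeD2r //; apply: IH => //; first exact: measurableD.
  move=> y ys; have [mFy FyB] := FB y (mem_behead (s := x :: s) ys); split => // t Fyt.
  split; first exact: FyB.
  move=> Fxt; have xy : x = y by apply: Fd; rewrite ?mem_head ?inE ?ys ?orbT //; exists t.
  by move: xs; rewrite xy ys.
by move=> y z ys zs; apply: Fd; rewrite inE ?ys ?zs orbT.
Qed.

(** The restriction of [k] to the tree down to depth [r], as an element of a countable type: shapes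
    can then be enumerated and summed over. *)
Definition gw_code q r (k : gw_label q -> nat) : seq (gw_label q * nat) :=
  [seq (u, k u) | u <- gw_labels k r].

(** Comparing on the labels of [k] alone suffices, since agreement there forces the two sets of
    labels to coincide. *)
Lemma gw_codeP q r (k k' : gw_label q -> nat) :
  gw_code r k = gw_code r k' <-> (forall u, u \in gw_labels k r -> k u = k' u).
Proof.
split=> [kk' u uk|kk'].
  have : (u, k u) \in gw_code r k by apply/mapP; exists u.
  by rewrite kk' => /mapP[v _ [-> ->]].
have DE : gw_labels k r = gw_labels k' r.
  apply/fsetP => u; apply/idP/idP => /in_gw_labels[Vu ur]; apply/in_gw_labels; split => //.
    apply/(gw_vertices_eq (k := k) (r := r)) => //; last exact: leqW.
    by move=> v Vv vr; apply: kk'; apply/in_gw_labels.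
  apply/(gw_vertices_eq (k := k) (r := r) (k' := k')) => //; last exact: leqW.
  by move=> v Vv vr; apply: kk'; apply/in_gw_labels.
by rewrite /gw_code -DE; apply/eq_in_map => u /kk' ->.
Qed.

(** * Disjoint explorations, grouped by shape *)

Section explore_sum.
Local Open Scope ereal_scope.
Context d (Omega : measurableType d) (R : realType) (P : probability Omega R).
Context (q N : nat) (i : 'I_N) (H : random_hypergraph Omega N) (r : nat).
Implicit Types k : gw_label q -> nat.

Lemma explore_event_tree k (s : {ffun gw_labels k r -> {set {set 'I_N}}}) w :
  s \in injective_families i k r -> explore_event i H s w ->
  rooted_iso (hball (H w) i r) i (hball (gw_graph k) [::] r) [::].
Proof.
move=> sI Hw; have sF : s \in block_families k r by move: sI; rewrite inE => /andP[].
apply: rooted_iso_trans (explores_hball (extend_uniform sF) (injective_families_inj sI) _ Hw) _.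
  exact: rdh_verts.
apply: rooted_iso_sym; first by apply: hball_root; exact: gw_root_vertex.
apply: gw_hball_eq => u /in_gw_labels[Vu ur]; exact: nblocks_extend.
Qed.

(** The choices [s] and [s'] are indexed by different label sets, hence the comparison through
    [extend]. For equal shapes this gives disjointness of distinct explorations; in general it shows
    that the shape is determined by the hypergraph. *)
Lemma explore_event_label k k' (s : {ffun gw_labels k r -> {set {set 'I_N}}})
    (s' : {ffun gw_labels k' r -> {set {set 'I_N}}}) w :
  s \in injective_families i k r -> s' \in injective_families i k' r ->
  explore_event i H s w -> explore_event i H s' w ->
  forall u, u \in gw_labels k r -> u \in gw_labels k' r /\ extend s u = extend s' u.
Proof.
move=> sI s'I ws ws' u.
have sF : s \in block_families k r by move: sI; rewrite inE => /andP[].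
have s'F : s' \in block_families k' r by move: s'I; rewrite inE => /andP[].
move=> /(tree_vertex_extend sF) ur.
have [ur' _ ss'] := explores_unique (extend_uniform sF) (extend_uniform s'F)
  (injective_families_inj sI) (injective_families_inj s'I) ws ws' ur.
by split => //; apply/(tree_vertex_extend s'F).
Qed.

Lemma explore_event_code k k' (s : {ffun gw_labels k r -> {set {set 'I_N}}})
    (s' : {ffun gw_labels k' r -> {set {set 'I_N}}}) w :
  s \in injective_families i k r -> s' \in injective_families i k' r ->
  explore_event i H s w -> explore_event i H s' w -> gw_code r k = gw_code r k'.
Proof.
move=> sI s'I ws ws'; apply/gw_codeP => u uk.
have sF : s \in block_families k r by move: sI; rewrite inE => /andP[].
have s'F : s' \in block_families k' r by move: s'I; rewrite inE => /andP[].
have [uk' ss'] := explore_event_label sI s'I ws ws' uk.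
have [Vu ur] := (in_gw_labels _ _ _).1 uk; have [Vu' _] := (in_gw_labels _ _ _).1 uk'.
by rewrite (nblocks_extend sF) // (nblocks_extend s'F) // /nblocks ss'.
Qed.

Definition shape_event k : set Omega := \bigcup_(s in [set` injective_families i k r])
  explore_event i H s.

Lemma measurable_shape_event k : measurable (shape_event k).
Proof.
apply: fin_bigcup_measurable => [|s sI]; first exact: finite_finset.
exact: measurable_explore_event sI.
Qed.

Lemma shape_event_ge alpha k :
  (0 < alpha < 1)%R -> erdos_renyi P q.+1 alpha H ->
  (#|injective_families i k r|%:R *
    (alpha ^+ (\sum_(x : gw_labels k r) k (val x)) *
     (1 - alpha) ^+ (#|` gw_labels k r| * 'C(N, q))))%:E <= P (shape_event k).
Proof.
move=> a01 HER; set b := (alpha ^+ _ * _)%R.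
apply: (@le_trans _ _ (\sum_(s <- enum (injective_families i k r)) P (explore_event i H s))).
  rewrite big_enum /= mulr_natl -sumr_const -sumEFin; apply: lee_sum => s sI.
  exact: explore_event_ge.
apply: sum_measure_le; first exact: enum_uniq.
- exact: measurable_shape_event.
- move=> s; rewrite mem_enum => sI; split; first exact: measurable_explore_event sI.
  by move=> w ws; exists s.
- move=> s s'; rewrite !mem_enum => sI s'I [w [ws ws']]; apply/ffunP => x.
  by rewrite -!extend_val; exact: (explore_event_label sI s'I ws ws' (valP x)).2.
Qed.

(** Shapes occurring in the same outcome have the same code, so the events of distinct codes are
    disjoint; each of them forces a ball that puts the component in [U]. *)
Lemma shape_event_le (cs : seq (seq (gw_label q * nat))) (U : set Hstar)
    (f : seq (gw_label q * nat) -> gw_label q -> nat) :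
  measurable U -> uniq cs -> (forall x, x \in cs -> gw_code r (f x) = x) ->
  (forall x, x \in cs -> forall (T : countType) (G : rooted_hypergraph T),
     rooted_iso (hball G (rh_root G) r) (rh_root G)
       (hball (gw_graph (f x)) [::] r) [::] -> U (iso_class G)) ->
  \sum_(x <- cs) P (shape_event (f x)) <= P (component_class H i @^-1` U).
Proof.
move=> mU ucs fcs fU; apply: sum_measure_le => //.
- by rewrite -[X in measurable X]setTI; exact: measurable_component_class.
- move=> x xcs; split; first exact: measurable_shape_event.
  move=> w [s sI ws]; apply: (fU x xcs).
  apply: rooted_iso_trans (hball_component _ _ _) _.
  exact: explore_event_tree ws.
- move=> x y xcs ycs [w [[s sI ws] [s' s'I ws']]].
  by rewrite -(fcs x) // -(fcs y) //; exact: explore_event_code ws ws'.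
Qed.

End explore_sum.

(** * Asymptotics of the lower bound *)

Lemma ffact_le_exp m n k : (m <= n)%N -> (m ^_ k <= n ^ k)%N.
Proof.
move=> mn; elim: k => // k IH; rewrite ffactnSr expnSr leq_mul //.
exact: leq_trans (leq_subr _ _) mn.
Qed.

Section asymptotics.
Context {R : realType}.
Implicit Types (m q : nat) (a : R).

Lemma cvg_inv_natr : (n%:R^-1 : R) @[n --> \oo] --> 0.
Proof.
apply/gtr0_cvgV0; first by near=> n; rewrite ltr0n; near: n; exists 1%N.
apply/cvgrnyP; exact: cvg_id.
Unshelve. all: by end_near. Qed.

Lemma ffact_ratio_cvg m : ((n ^_ m)%:R / n%:R ^+ m : R) @[n --> \oo] --> (1 : R).
Proof.
elim: m => [|m IH].
  by under eq_cvg do rewrite ffactn0 expr0 divr1; exact: cvg_cst.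
have cm : (1 - m%:R * n%:R^-1 : R) @[n --> \oo] --> (1 : R).
  rewrite -[X in _ --> X]subr0 -[X in 1 - X](mulr0 m%:R).
  by apply: cvgB; [exact: cvg_cst|apply: cvgM; [exact: cvg_cst|exact: cvg_inv_natr]].
rewrite -[X in _ --> X]mulr1; apply: cvg_trans (cvgM IH cm).
apply: near_eq_cvg; near=> n.
have n0 : (n%:R : R) != 0 by rewrite pnatr_eq0 -lt0n; near: n; exists 1%N.
have mn : (m <= n)%N by near: n; exists m.
by rewrite ffactnSr natrM natrB // exprS /=; field; rewrite n0 expf_neq0.
Unshelve. all: by end_near. Qed.

Lemma bin_ratio_cvg m : ('C(n, m)%:R / n%:R ^+ m : R) @[n --> \oo] --> (m`!%:R^-1 : R).
Proof.
rewrite -[X in _ --> X]mul1r.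
under eq_cvg => n.
  rewrite (_ : _ / _ = ((n ^_ m)%:R / n%:R ^+ m) * (m`!%:R^-1 : R)); last first.
    by rewrite -bin_ffact natrM mulrAC mulfK // pnatr_eq0 -lt0n fact_gt0.
  over.
by apply: cvgM; [exact: ffact_ratio_cvg|exact: cvg_cst].
Qed.

Lemma leq_bin n q : (0 < q)%N -> (n - q <= 'C(n, q))%N.
Proof.
case: q => // q _; elim: n => [//|n IH].
rewrite binS; have [nq|qn] := leqP n q.
  by rewrite (eqP (_ : n.+1 - q.+1 == 0)%N) // subn_eq0.
by rewrite subSS -(subnSK qn) -addn1 leq_add // bin_gt0 ltnW.
Qed.

Lemma bin_cvgny q : (0 < q)%N -> 'C(n, q) @[n --> \oo] --> \oo.
Proof.
move=> q0; apply/cvgnyPge => A; near=> n.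
apply: leq_trans (leq_bin n q0); rewrite leq_subRL; last by near: n; exists q.
by near: n; exists (q + A)%N.
Unshelve. all: by end_near. Qed.

(** With [C] for ['C(n, q)], the ratio is ['C(C, m) / C ^+ m] times [(C / n ^+ q) ^+ m], and [C]
    tends to infinity because [q] is positive. *)
Lemma bin_bin_ratio_cvg q m : (0 < q)%N ->
  ('C('C(n, q), m)%:R / n%:R ^+ (q * m) : R) @[n --> \oo] -->
  (m`!%:R^-1 * q`!%:R^-1 ^+ m : R).
Proof.
move=> q0.
have c1 : ('C('C(n, q), m)%:R / 'C(n, q)%:R ^+ m : R) @[n --> \oo] --> (m`!%:R^-1 : R).
  by have := cvg_comp _ _ (bin_cvgny q0) (@bin_ratio_cvg m); apply.
have c2 : (('C(n, q)%:R / n%:R ^+ q) ^+ m : R) @[n --> \oo] --> (q`!%:R^-1 ^+ m : R).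
  by have := cvg_comp _ _ (@bin_ratio_cvg q) (@exprn_continuous R m _); apply.
apply: cvg_trans (cvgM c1 c2); apply: near_eq_cvg; near=> n.
have q0' : ('C(n, q)%:R : R) != 0.
  by rewrite pnatr_eq0 -lt0n bin_gt0; near: n; exists q.
by rewrite /= exprM expr_div_n mulrA divfK // expf_neq0.
Unshelve. all: by end_near. Qed.

(** The inverse of [1 - a] is [1 + a / (1 - a)], which is at most the exponential of
    [a / (1 - a)]. *)
Lemma exprB1_ge a m : 0 < a < 1 -> expR (- (m%:R * (a / (1 - a)))) <= (1 - a) ^+ m.
Proof.
move=> /andP[a0 a1]; have a1' : 0 < 1 - a by rewrite subr_gt0.
rewrite -mulrN expRM_natl; apply: lerXn2r; [by rewrite nnegrE expR_ge0|by rewrite nnegrE ltW|].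
rewrite expRN invf_ple ?posrE ?expR_gt0 //.
apply: le_trans (expR_ge1Dx _).
by rewrite le_eqVlt; apply/orP; left; apply/eqP; field; rewrite gt_eqF.
Qed.

Context (q : nat) (c : R) (k : gw_label q -> nat) (r : nat).
Local Notation D := (gw_labels k r).
Local Notation e := (\sum_(x : D) k (val x))%N.

(* The number of admissible choices, times the probability of each of them, with
   (1 - a) ^+ m replaced by the lower bound of [exprB1_ge]. *)
Definition shape_bound (N : nat) : R :=
  let a := c / N%:R ^+ q in
  (\prod_(x : D) 'C('C(N, q), k (val x))%:R - (N ^ (q * e) - N.-1 ^_ (q * e))%:R) *
  (a ^+ e * expR (- ((#|` D| * 'C(N, q))%:R * (a / (1 - a))))).

Lemma shape_bound_cvg : (0 < q)%N -> 0 < c ->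
  shape_bound N @[N --> \oo] --> \prod_(x : D) poisson_pmf (c / q`!%:R) (k (val x)).
Proof.
move=> q0 c0.
have c1 : (\prod_(x : D) ('C('C(N, q), k (val x))%:R / N%:R ^+ (q * k (val x))) : R)
    @[N --> \oo] --> (\prod_(x : D) ((k (val x))`!%:R^-1 * q`!%:R^-1 ^+ k (val x)) : R).
  by apply: cvg_big => [|x _]; [exact: mul_continuous|exact: bin_bin_ratio_cvg].
(* The correction divided by [N ^ (q * e)]: after multiplication of numerator and denominator by
   [N], the falling factorial of [N.-1] becomes one of [N] with one more factor. *)
have c2 : (1 - (N ^_ (q * e).+1)%:R / N%:R ^+ (q * e).+1 : R) @[N --> \oo] --> (1 - 1 : R).
  by apply: cvgB; [exact: cvg_cst|exact: ffact_ratio_cvg].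
have ca : (c / N%:R ^+ q : R) @[N --> \oo] --> (0 : R).
  rewrite -[X in _ --> X](mulr0 c); apply: cvgM; first exact: cvg_cst.
  have := cvg_comp _ _ cvg_inv_natr (@exprn_continuous R q _).
  rewrite expr0n gtn_eqF //= => h; under eq_cvg do rewrite -exprVn.
  exact: h.
have c3 : (#|` D|%:R * ('C(N, q)%:R / N%:R ^+ q * (c / (1 - c / N%:R ^+ q))) : R)
    @[N --> \oo] --> (#|` D|%:R * (q`!%:R^-1 * (c / (1 - 0))) : R).
  apply: cvgM; first exact: cvg_cst.
  apply: cvgM; first exact: bin_ratio_cvg.
  apply: cvgM; first exact: cvg_cst.
  by apply: cvgV; [rewrite subr0 oner_neq0|apply: cvgB => //; exact: cvg_cst].
have c4 : (expR (- (#|` D|%:R * ('C(N, q)%:R / N%:R ^+ q * (c / (1 - c / N%:R ^+ q))))) : R)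
    @[N --> \oo] --> (expR (- (#|` D|%:R * (q`!%:R^-1 * (c / (1 - 0))))) : R).
  by apply: cvg_comp (cvgN c3) _; exact: continuous_expR.
have cc : (c ^+ e : R) @[_ --> \oo] --> (c ^+ e : R) by exact: cvg_cst.
(* The factor [c ^+ e] and the exponential, whose exponent is proportional to the number of labels,
   are distributed over [D]; each label receives one Poisson weight. *)
have <- : (\prod_(x : D) ((k (val x))`!%:R^-1 * q`!%:R^-1 ^+ k (val x)) - (1 - 1)) *
    (c ^+ e * expR (- (#|` D|%:R * (q`!%:R^-1 * (c / (1 - 0)))))) =
    \prod_(x : D) poisson_pmf (c / q`!%:R) (k (val x)).
  rewrite subrr subr0 /poisson_pmf divr_gt0 ?ltr0n ?fact_gt0 // subr0 divr1.
  rewrite -mulrN expRM_natl cardfE -prodr_const expr_sum -!big_split /=.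
  apply: eq_bigr => x _; rewrite expr_div_n exprVn.
  by rewrite [q`!%:R^-1 * c]mulrC; ring.
apply: cvg_trans (cvgM (cvgB c1 c2) (cvgM cc c4)); apply: near_eq_cvg; near=> N.
have N0 : (N%:R : R) != 0 by rewrite pnatr_eq0 -lt0n; near: N; exists 1%N.
rewrite /shape_bound !fctE /=; set M := (q * e)%N; set a := c / N%:R ^+ q.
have -> : ('C(N, q)%:R / N%:R ^+ q * (c / (1 - a)) : R) = 'C(N, q)%:R * (a / (1 - a)).
  by rewrite /a; ring.
have -> : \prod_(x : D) ('C('C(N, q), k (val x))%:R / N%:R ^+ (q * k (val x))) =
    (\prod_(x : D) 'C('C(N, q), k (val x))%:R) / N%:R ^+ M :> R.
  by rewrite big_split /= prodfV /M big_distrr /= expr_sum.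
have -> : (N ^_ M.+1)%:R / N%:R ^+ M.+1 = (N.-1 ^_ M)%:R / N%:R ^+ M :> R.
  by rewrite ffactnS natrM exprS invfM mulrACA divff // mul1r.
rewrite natrM natrB ?ffact_le_exp ?leq_pred //.
rewrite natrX -[_ * 'C(N, q)%:R * _]mulrA [a ^+ e]expr_div_n -exprM -/M.
have : (N%:R ^+ M : R) != 0 by rewrite expf_neq0.
move: (N%:R ^+ M) (\prod_(x : D) _) (_ ^_ M)%:R (c ^+ e) (expR _) => Y X Z V W Y0.
by field.
Unshelve. all: by end_near. Qed.

End asymptotics.

(** * Weak convergence from lower bounds on open sets *)

(** The sum rounds [y] down to the grid of step [h]. Strict inequalities are used so that the
    superlevel sets of a continuous function are open. *)
Lemma step_le {R : realDomainType} (h y : R) n : 0 <= y ->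
  \sum_(j < n) h * (j.+1%:R * h < y)%R%:R <= y.
Proof.
move=> y0; have [h0|h0] := leP h 0.
  by apply: le_trans y0; apply: sumr_le0 => j _; rewrite mulr_le0_ge0.
elim: n => [|n IH]; first by rewrite big_ord0.
have [ny|yn] := ltP (n.+1%:R * h) y; last by rewrite big_ord_recr /= ltNge yn mulr0 addr0.
rewrite (eq_bigr (fun=> h)).
  by rewrite sumr_const card_ord -mulr_natl ltW.
move=> j _; rewrite (le_lt_trans _ ny) ?mulr1 //.
by rewrite ler_pM2r // ler_nat.
Qed.

Lemma step_ge {R : realDomainType} (h y : R) n : 0 <= h -> y <= n.+1%:R * h ->
  y <= \sum_(j < n) h * (j.+1%:R * h < y)%R%:R + h.
Proof.
move=> h0; elim: n => [|n IH] yn; first by rewrite big_ord0 add0r -[h]mul1r.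
have [ny|yn'] := ltP (n.+1%:R * h) y; last first.
  by rewrite big_ord_recr /= [_ < _]ltNge yn' mulr0 addr0; exact: IH.
rewrite (eq_bigr (fun=> h)).
  by rewrite sumr_const card_ord -mulr_natl; apply: le_trans yn _; rewrite [n.+2%:R]mulrSr mulrDl mul1r.
move=> j _; rewrite (le_lt_trans _ ny) ?mulr1 //.
by rewrite ler_wpM2r // ler_nat.
Qed.

Section weak.
Context {R : realType}.
Implicit Types (nu : {measure set Hstar -> \bar R}) (f g : Hstar -> R).

Lemma open_measurable_Hstar (U : set Hstar) : open U -> measurable U.
Proof. exact: sub_gen_smallest. Qed.

Lemma continuous_measurable_Hstar f : continuous f -> measurable_fun setT f.
Proof.
move=> /continuousP cf; apply: (measurability _ (RGenOInfty.measurableE R)) => //.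
move=> _ [_ [x ->] <-]; rewrite setTI; apply: open_measurable_Hstar.
by apply: cf; rewrite set_itvE; exact: open_gt.
Qed.

Lemma open_superlevel f a : continuous f -> open [set x | a < f x].
Proof.
move=> /continuousP/(_ [set y | a < y]).
by apply; exact: open_gt.
Qed.

Lemma bounded_integrable_Hstar nu f : nu setT = 1%E -> continuous f -> bounded_fun f ->
  nu.-integrable setT (EFin \o f).
Proof.
move=> nu1 cf bf; apply: measurable_bounded_integrable => //.
  by rewrite nu1 ltry.
exact: continuous_measurable_Hstar.
Qed.

Definition layer_sum nu g h n : R :=
  \sum_(j < n) h * fine (nu [set x | j.+1%:R * h < g x]).

(** Integrating the pointwise bounds [step_le] and [step_ge] leaves only measures of open sets; the
    error [h] is not multiplied further because the total mass is 1. *)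
Lemma layer_cake nu g h n : nu setT = 1%E -> continuous g ->
  0 <= h -> (forall x, 0 <= g x <= n.+1%:R * h) ->
  layer_sum nu g h n <= \int[nu]_x g x <= layer_sum nu g h n + h.
Proof.
move=> nu1 cg h0 gb; set S := layer_sum _ _ _ _; pose A j := [set x | j.+1%:R * h < g x].
have mg := continuous_measurable_Hstar cg.
have mA j : measurable (A j).
  by apply: open_measurable_Hstar; exact: open_superlevel.
have nuA j : nu (A j) \is a fin_num.
  apply: lty_fin_num_fun => //; by rewrite nu1 ltry.
have bg : bounded_fun g.
  exists (n.+1%:R * h); split; rewrite ?num_real // => M hM x _ /=.
  by have /andP[g0 gn] := gb x; rewrite ger0_norm // (le_trans gn) // ltW.
have ig := bounded_integrable_Hstar nu1 cg bg.
pose s x := \sum_(j < n) h * (j.+1%:R * h < g x)%R%:R.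
have sE x : s x = \sum_(j < n) h * \1_(A j) x.
  apply: eq_bigr => j _; rewrite indicE; congr (_ * _%:R).
  by congr nat_of_bool; apply/idP/idP; rewrite inE.
have intS : (\int[nu]_x (s x)%:E = S%:E)%E.
  under eq_integral do rewrite sE -sumEFin.
  rewrite ge0_integral_sum //; last 2 first.
  - by move=> j; apply/measurable_EFinP; apply: measurable_funM => //; exact: measurable_indic.
  - by move=> j x _; rewrite lee_fin mulr_ge0 // indicE ler0n.
  rewrite -sumEFin; apply: eq_bigr => j _.
  under eq_integral do rewrite EFinM.
  rewrite ge0_integralZl_EFin //; last exact/measurable_EFinP/measurable_indic.
  by rewrite integral_indic // setIT EFinM (fineK (nuA j)).
have ms : measurable_fun setT s.
  rewrite (_ : s = fun x => \sum_(j < n) h * \1_(A j) x); last exact/funext.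
  by apply: measurable_sum => j; apply: measurable_funM => //; exact: measurable_indic.
have s0 x : 0 <= s x by apply: sumr_ge0 => j _; rewrite mulr_ge0.
have g0 x : 0 <= g x by case/andP: (gb x).
rewrite -!lee_fin /Rintegral fineK ?integrable_fin_num // EFinD -intS; apply/andP; split.
  apply: ge0_le_integral => //.
  - by move=> x _; rewrite lee_fin.
  - exact/measurable_EFinP.
  - exact/measurable_EFinP.
  - by move=> x _; rewrite lee_fin step_le.
have <- : (\int[nu]_x h%:E = h%:E)%E by rewrite integral_cst // nu1 mule1.
rewrite -ge0_integralD //.
apply: ge0_le_integral => //.
- by move=> x _; rewrite lee_fin.
- exact/measurable_EFinP.
- by apply: emeasurable_funD => //; exact/measurable_EFinP.
- by move=> x _; rewrite -EFinD lee_fin step_ge //; case/andP: (gb x).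
- by move=> x _; rewrite lee_fin.
- exact/measurable_EFinP.
Qed.

(** A portmanteau argument: lower bounds on open sets give lower bounds on integrals of nonnegative
    bounded continuous functions, and these, applied to [f + M] and [M - f], bound the integrals of
    [f] from both sides. Mass 1 is asked only eventually, since the mean law vanishes for
    [N = 0]. *)
Lemma weak_cvg_open (mu_ : nat -> {measure set Hstar -> \bar R})
    (mu : {measure set Hstar -> \bar R}) :
  (\forall N \near \oo, mu_ N setT = 1%E) -> mu setT = 1%E ->
  (forall U, open U -> forall eps : R, 0 < eps ->
     \forall N \near \oo, (mu U - eps%:E <= mu_ N U)%E) ->
  weak_cvg mu_ mu.
Proof.
move=> mu_1 mu1 muU.
have lower g B eps : continuous g -> (forall x, 0 <= g x <= B) -> 0 < eps ->
    \forall N \near \oo, \int[mu]_x g x - eps <= \int[mu_ N]_x g x.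
  (* One half of [eps] pays for the rounding to multiples of [h]; the other half pays for the [n]
     open sets, each losing at most [n.+1%:R^-1] with weight [h]. *)
  move=> cg gB e0; pose h := eps / 2; have h0 : 0 < h by rewrite divr_gt0.
  have [n Bn] : exists n, B <= n.+1%:R * h.
    exists (Num.truncn (B / h)); rewrite -ler_pdivrMr //.
    exact/ltW/truncnS_gt.
  have gb x : 0 <= g x <= n.+1%:R * h.
    by have /andP[-> /le_trans->] := gB x.
  have oA (j : 'I_n) : open [set x | j.+1%:R * h < g x].
    exact: open_superlevel.
  have d0 : 0 < n.+1%:R^-1 :> R by rewrite invr_gt0.
  have nA : \forall N \near \oo, forall j : 'I_n,
      (mu [set x | (j.+1%:R * h < g x)%R] - (n.+1%:R^-1)%:E <=
       mu_ N [set x | (j.+1%:R * h < g x)%R])%E.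
    by apply: filter_forall => j; exact: muU (oA j) _ d0.
  near=> N.
  have mu_N1 : mu_ N setT = 1%E by near: N.
  have /andP[_ up] := layer_cake mu1 cg (ltW h0) gb.
  have /andP[+ _] := layer_cake mu_N1 cg (ltW h0) gb; apply: le_trans.
  have NA : forall j : 'I_n, (mu [set x | (j.+1%:R * h < g x)%R] - (n.+1%:R^-1)%:E <=
       mu_ N [set x | (j.+1%:R * h < g x)%R])%E by near: N.
  have fin (nu : {measure set Hstar -> \bar R}) (j : 'I_n) : nu setT = 1%E ->
      nu [set x | (j.+1%:R * h < g x)%R] \is a fin_num.
    move=> nu1; apply: lty_fin_num_fun; first by rewrite nu1 ltry.
    by apply: open_measurable_Hstar; exact: oA.
  have {}NA (j : 'I_n) : fine (mu [set x | j.+1%:R * h < g x]) - n.+1%:R^-1 <=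
      fine (mu_ N [set x | j.+1%:R * h < g x]).
    by rewrite -lee_fin EFinB !fineK ?fin.
  rewrite lerBlDr; apply: le_trans up _; rewrite /layer_sum.
  apply: (@le_trans _ _ (\sum_(j < n) (h * fine (mu_ N [set x | j.+1%:R * h < g x])
     + h * n.+1%:R^-1) + h)).
    by rewrite lerD2r; apply: ler_sum => j _; rewrite -mulrDr ler_pM2l // -lerBlDr.
  rewrite big_split /= -addrA lerD2l sumr_const card_ord.
  have hn : h * n.+1%:R^-1 * n%:R <= h.
    rewrite -mulrA ler_piMr //; first exact: ltW.
    by rewrite mulrC ler_pdivrMr // mul1r ler_nat.
  have epsE : h + h = eps by rewrite /h -splitr.
  by rewrite -epsE lerD2r -[X in X <= _]mulr_natr.
move=> f cf [M0 [_ bM0]]; pose M := `|M0| + 1.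
have fM x : `|f x| <= M.
  by apply: bM0 => //; rewrite /M (le_lt_trans (ler_norm _)) // ltrDl.
have bf : bounded_fun f.
  by exists M; split; rewrite ?num_real // => K /ltW MK x _ /=; exact: le_trans MK.
have intf nu : nu setT = 1%E -> (\int[nu]_x (f x)%:E = (\int[nu]_x f x)%:E)%E.
  move=> nu1; rewrite /Rintegral fineK // integrable_fin_num //.
  exact: bounded_integrable_Hstar.
have mc : continuous ((fun=> M) : Hstar -> R) by move=> x; exact: cst_continuous.
have cfM : continuous (fun x => f x + M) by move=> x; exact: (cvgD (cf x) (mc x)).
have cMf : continuous (fun x => M - f x) by move=> x; exact: (cvgB (mc x) (cf x)).
have icst nu : nu setT = 1%E -> nu.-integrable setT (EFin \o (fun=> M)).
  move=> nu1; apply: bounded_integrable_Hstar => //.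
  by exists M; split; rewrite ?num_real // => K /ltW MK x _ /=; rewrite ger0_norm // addr_ge0.
have intD nu : nu setT = 1%E -> \int[nu]_x (f x + M) = \int[nu]_x f x + M.
  move=> nu1; rewrite RintegralD //; [|exact: bounded_integrable_Hstar|exact: icst].
  by rewrite Rintegral_cst // nu1 mulr1.
have intB nu : nu setT = 1%E -> \int[nu]_x (M - f x) = M - \int[nu]_x f x.
  move=> nu1; rewrite RintegralB //; [|exact: icst|exact: bounded_integrable_Hstar].
  by rewrite Rintegral_cst // nu1 mulr1.
have f1 x : 0 <= f x + M <= M + M.
  by have := fM x; rewrite ler_norml => /andP[f1 f2]; rewrite -lerBlDr sub0r f1 lerD2r.
have f2 x : 0 <= M - f x <= M + M.
  by have := fM x; rewrite ler_norml => /andP[f2 f3]; rewrite subr_ge0 f3 lerD2l lerNl.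
have cR : (\int[mu_ N]_x f x)%:E @[N --> \oo] --> (\int[mu]_x f x)%:E.
  apply: cvg_EFin; first by near=> N.
  apply/cvgrPdist_le => eps e0; near=> N => /=.
  have mu_N1 : mu_ N setT = 1%E by near: N.
  have l1 : \int[mu]_x (f x + M) - eps <= \int[mu_ N]_x (f x + M).
    by near: N; exact: (lower _ _ _ cfM f1 e0).
  have l2 : \int[mu]_x (M - f x) - eps <= \int[mu_ N]_x (M - f x).
    by near: N; exact: (lower _ _ _ cMf f2 e0).
  rewrite !intD // in l1; rewrite !intB // in l2.
  rewrite ler_norml; apply/andP; split; lra.
rewrite intf //; apply: cvg_trans cR; apply: near_eq_cvg; near=> N.
by rewrite /= intf //; near: N.
Unshelve. all: by end_near. Qed.

End weak.

(** * The lower bound for open sets *)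

Section lower_bound.
Local Open Scope ereal_scope.
Context d (Omega : measurableType d) (R : realType) (P : probability Omega R).
Context (q N : nat) (H : random_hypergraph Omega N) (c : R).
Hypotheses (a01 : (0 < c / N%:R ^+ q < 1)%R) (HER : erdos_renyi P q.+1 (c / N%:R ^+ q) H).

Lemma shape_bound_le (k : gw_label q -> nat) r (i : 'I_N) :
  (shape_bound c k r N)%:E <= P (shape_event i H r k).
Proof.
apply: le_trans _ (shape_event_ge i _ _ a01 HER); rewrite lee_fin /shape_bound.
have [a0 a1] := andP a01; apply: (@le_trans _ _ (#|injective_families i k r|%:R *
    ((c / N%:R ^+ q) ^+ (\sum_(x : gw_labels k r) k (val x)) *
     expR (- ((#|` gw_labels k r| * 'C(N, q))%:R * (c / N%:R ^+ q / (1 - c / N%:R ^+ q))))))%R).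
  apply: ler_wpM2r; first by rewrite mulr_ge0 ?expR_ge0 ?exprn_ge0 // ltW.
  rewrite lerBlDr -natr_prod -natrD ler_nat; exact: card_injective_families.
apply: ler_wpM2l => //; apply: ler_wpM2l; first by rewrite exprn_ge0 // ltW.
exact: exprB1_ge.
Qed.

Lemma mean_lawE (U : set Hstar) : measurable U ->
  mean_law P H U = N%:R^-1%:E * \sum_(i < N) P (component_class H i @^-1` U).
Proof.
move=> mU; rewrite /mean_law ge0_integralZl_EFin //; last 2 first.
- by move=> w _; exact: sume_ge0.
- apply: emeasurable_sum => i.
  exact: measurableT_comp (measurable_fun_dirac mU) (measurable_component_class H i).
rewrite ge0_integral_sum //; last first.
  move=> i; exact: measurableT_comp (measurable_fun_dirac mU) (measurable_component_class H i).
congr (_ * _); apply: eq_bigr => i _.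
rewrite (eq_integral (fun w => (\1_(component_class H i @^-1` U) w)%:E)); last first.
  by move=> w _; rewrite diracE indicE; congr (_%:R)%:E; congr nat_of_bool;
    apply/idP/idP; rewrite !inE.
rewrite integral_indic // ?setIT //.
by rewrite -[X in measurable X]setTI; exact: measurable_component_class.
Qed.

Lemma mean_law_ge (U : set Hstar) (b : R) : (0 < N)%N -> measurable U ->
  (forall i, b%:E <= P (component_class H i @^-1` U)) -> b%:E <= mean_law P H U.
Proof.
move=> N0 mU bP; rewrite mean_lawE //.
apply: (@le_trans _ _ (N%:R^-1%:E * \sum_(i < N) b%:E)).
  rewrite sumEFin sumr_const card_ord -EFinM lee_fin -[(b *+ N)%R]mulr_natl mulKf //.
  by rewrite pnatr_eq0 -lt0n.
by rewrite lee_wpmul2l ?lee_fin ?invr_ge0 //; apply: lee_sum.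
Qed.

End lower_bound.

Lemma mean_lawT d (Omega : measurableType d) (R : realType) (P : probability Omega R)
  N (H : random_hypergraph Omega N) : (0 < N)%N -> mean_law P H setT = 1%E.
Proof.
move=> N0; rewrite mean_lawE //; under eq_bigr do rewrite preimage_setT probability_setT.
rewrite sumEFin sumr_const card_ord -EFinM mulVf //.
by rewrite pnatr_eq0 -lt0n.
Qed.

Lemma nondecreasing_measure_ge d (T : measurableType d) (R : realType)
    (mu : probability T R) (F : (set T)^nat) (e : R) :
  (forall n, measurable (F n)) -> nondecreasing_seq F -> 0 < e ->
  exists n, (mu (\bigcup_n F n) - e%:E <= mu (F n))%E.
Proof.
move=> mF ndF e0; apply: contrapT => /forallNP nF.
have mU : measurable (\bigcup_n F n) by exact: bigcup_measurable.
have cmu : (mu \o F) n @[n --> \oo] --> mu (\bigcup_n F n).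
  exact: nondecreasing_cvg_mu.
have : (mu (\bigcup_n F n) <= mu (\bigcup_n F n) - e%:E)%E.
  apply: cvge_le cmu; near=> n => /=; apply: ltW; rewrite ltNge; exact/negP/nF.
have muf : mu (\bigcup_n F n) \is a fin_num by exact: fin_num_measure.
by rewrite leNgt => /negP[]; rewrite lteBlDr // lteDl // lte_fin.
Unshelve. all: by end_near. Qed.

Lemma measure_bigcup_seq_le d (T : measurableType d) (R : realType)
    (mu : {measure set T -> \bar R}) (I : eqType) (s : seq I) (F : I -> set T) (B : set T) :
  measurable B -> (forall x, x \in s -> measurable (F x)) ->
  B `<=` \bigcup_(x in [set` s]) F x -> (mu B <= \sum_(x <- s) mu (F x))%E.
Proof.
elim: s B => [|x s IH] B mB mF BF.
  have -> : B = set0 by apply/seteqP; split => // w /BF[].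
  by rewrite measure0 big_nil.
have mFx := mF x (mem_head _ _).
rewrite big_cons -{1}(classical_sets.setUIDK B (F x)) measureU; [|exact: measurableI|exact: measurableD|]; last first.
  by apply/seteqP; split => // w [[_ Fw] [_ /(_ Fw)]].
rewrite leeD //.
  by apply: le_measure; rewrite ?inE //; exact: measurableI.
apply: IH => [|y ys|w [/BF[y /= + Fyw] nFx]]; first exact: measurableD.
  by apply: mF; rewrite inE ys orbT.
by rewrite inE => /predU1P[yx|ys]; [rewrite yx in Fyw|exists y].
Qed.

(** * Galton-Watson probabilities of shapes *)

Section gw_shapes.
Local Open Scope ereal_scope.
Context d (Omega : measurableType d) (R : realType) (P : probability Omega R).
Context (q : nat) (lambda : R) (K : gw_label q -> {RV P >-> nat}).
Hypothesis PK : poisson_offspring lambda K.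

Lemma gw_code_eventE r k : [set w | gw_code r (K^~ w) = gw_code r k] =
  \bigcap_(u in [set` gw_labels k r]) K u @^-1` [set k u].
Proof.
apply/seteqP; split => w /= wk.
  by move=> u ur; move/esym/gw_codeP: wk => /(_ u ur).
by apply/esym/gw_codeP => u ur; rewrite wk.
Qed.

Lemma measurable_gw_code r k : measurable [set w | gw_code r (K^~ w) = gw_code r k].
Proof.
rewrite gw_code_eventE; apply: fin_bigcap_measurable => [|u _]; first exact: finite_seq.
by rewrite -[X in measurable X]setTI; exact: measurable_funPT.
Qed.

(** The labels concerned are those of the fixed [k], a deterministic finite set, so independence
    applies directly. *)
Lemma prob_gw_code r k : P [set w | gw_code r (K^~ w) = gw_code r k] =
  (\prod_(x : gw_labels k r) poisson_pmf lambda (k (val x)))%:E.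
Proof.
have [PKn indK] := PK.
rewrite gw_code_eventE (indK (fun u => [set k u])) ?fset_uniq //.
by under eq_bigr do rewrite PKn; rewrite prodEFin big_seq_fsetE.
Qed.

End gw_shapes.

Lemma erdos_renyi_parameter_near (R : realType) (c : R) q : (0 < q)%N -> 0 < c ->
  \forall N \near \oo, 0 < c / N%:R ^+ q < 1.
Proof.
move=> q0 c0; near=> N; have N0 : (0 < N)%N by near: N; exists 1%N.
have Nq0 : 0 < N%:R ^+ q :> R by rewrite exprn_gt0 ?ltr0n.
rewrite divr_gt0 //= ltr_pdivrMr // mul1r.
apply: (@lt_le_trans _ _ N%:R); last by rewrite -natrX ler_nat -[leqLHS]expn1 leq_pexp2l.
by near: N; apply: nbhs_infty_gtr.
Unshelve. all: by end_near. Qed.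

Section mean_law_lower.
Context (R : realType) (q : nat) (c : R) (d : nat -> measure_display).
Context (Omega : forall N, measurableType (d N)) (P : forall N, probability (Omega N) R).
Context (H : forall N, random_hypergraph (Omega N) N).
Context d' (Omega' : measurableType d') (P' : probability Omega' R).
Context (K : gw_label q -> {RV P' >-> nat}).
Hypotheses (q0 : (0 < q)%N) (c0 : 0 < c).
Hypothesis HER : forall N, 0 < c / N%:R ^+ q < 1 ->
  erdos_renyi (P N) q.+1 (c / N%:R ^+ q) (H N).
Hypothesis PK : poisson_offspring (c / q`!%:R) K.
Context (U : set Hstar) (oU : open U).

Definition ball_inside r (k : gw_label q -> nat) :=
  forall (T : countType) (G : rooted_hypergraph T),
    rooted_iso (hball G (rh_root G) r) (rh_root G) (hball (gw_graph k) [::] r) [::] ->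
    U (iso_class G).

Lemma ball_inside_mono r s k : (r <= s)%N -> ball_inside r k -> ball_inside s k.
Proof.
move=> rs kU T G Gk; apply: kU; exact: hball_iso_le rs (rh_rootP G) Gk.
Qed.

Lemma ball_inside_code r k k' :
  gw_code r k = gw_code r k' -> ball_inside r k -> ball_inside r k'.
Proof.
move=> /esym/gw_codeP k'k kU T G Gk'; apply: kU.
by apply: rooted_iso_trans Gk' _; exact: gw_hball_eq.
Qed.

(** Openness of [U] is what makes some finite radius suffice; thus the event that the tree lies in
    [U] is an increasing union over [r]. *)
Lemma ball_insideP k : U (iso_class (gw_hypertree k)) <-> exists r, ball_inside r k.
Proof.
split=> [/(open_local_ball oU)[r kU]|[r]]; first by exists r; exact: kU.
by apply; exact: rooted_iso_refl.
Qed.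

(** The bound on [pickle] leaves only finitely many shapes. *)
Definition inside_event r m : set Omega' :=
  [set w | ball_inside r (K^~ w) /\ (choice.pickle (gw_code r (K^~ w)) < m)%N].

Lemma measurable_inside_event r m : measurable (inside_event r m).
Proof.
rewrite (_ : inside_event r m = \bigcup_x
    (if `[< exists2 k, gw_code r k = x & ball_inside r k >] && (choice.pickle x < m)%N
     then [set w | gw_code r (K^~ w) = x] else set0)).
  apply: countable_bigcupT_measurable; first exact: countableP.
  move=> x; case: ifP => [/andP[/asboolP[k <- _] _]|_]; last exact: measurable0.
  exact: measurable_gw_code.
apply/seteqP; split => [w [wU wm]|w [x _]].
  exists (gw_code r (K^~ w)) => //; rewrite wm andbT asboolT //.
  by exists (K^~ w).
case: ifP => // /andP[/asboolP[k <- kU] km] /= wk; split; last by rewrite wk.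
exact: ball_inside_code (esym wk) kU.
Qed.

(** Continuity from below is used twice, first in [r] and then in [m] with [r] fixed, at a cost of
    [e / 2] each. *)
Lemma inside_event_ge (e : R) : 0 < e ->
  exists r m, (gw_law K U - e%:E <= P' (inside_event r m))%E.
Proof.
move=> e0; have e20 : 0 < e / 2 by rewrite divr_gt0.
pose X r := \bigcup_m inside_event r m.
have mX r : measurable (X r).
  by apply: bigcup_measurable => m _; exact: measurable_inside_event.
have XE r : X r = [set w | ball_inside r (K^~ w)].
  apply/seteqP; split => [w [m _ []//]|w wU].
  by exists (choice.pickle (gw_code r (K^~ w))).+1 => //; split => /=.
have -> : gw_law K U = P' (\bigcup_r X r).
  rewrite /gw_law /distribution /pushforward /=; congr (P' _).
  apply/seteqP; split => [w /ball_insideP[r wU]|w [r _]].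
    by exists r => //; rewrite XE.
  by rewrite XE => wU; apply/ball_insideP; exists r.
have [r rX] : exists r, (P' (\bigcup_r X r) - (e / 2)%:E <= P' (X r))%E.
  apply: nondecreasing_measure_ge => // r s rs; apply/subsetPset => w.
  by rewrite !XE; exact: ball_inside_mono.
have [m mX'] : exists m, (P' (X r) - (e / 2)%:E <= P' (inside_event r m))%E.
  apply: nondecreasing_measure_ge => [m||//]; first exact: measurable_inside_event.
  move=> m n mn; apply/subsetPset => w [wU wm]; split => //; exact: leq_trans mn.
exists r, m; apply: le_trans mX'; rewrite leeBrDr // -addeA -EFinD.
apply: le_trans rX.
by rewrite leeD2l // lee_fin; lra.
Qed.

Lemma mean_law_lower (e : R) : 0 < e ->
  \forall N \near \oo, (gw_law K U - e%:E <= mean_law (P N) (H N) U)%E.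
Proof.
move=> e0; have e20 : 0 < e / 2 by rewrite divr_gt0.
have [r [m XU]] := inside_event_ge e20.
pose Q x := exists2 k, gw_code r k = x & ball_inside r k.
have /choice[f fP] : forall x, exists k, Q x -> gw_code r k = x /\ ball_inside r k.
  move=> x; have [[k kx kU]|nQ] := pselect (Q x); first by exists k.
  by exists (fun=> 0%N).
(* All codes with number below [m] that guarantee [U]; they are made distinct because the
   disjointness of shape events is between distinct codes. *)
pose cs := undup [seq x <- pmap choice.unpickle (iota 0 m) | `[< Q x >]].
have csQ x : x \in cs -> Q x by rewrite mem_undup mem_filter => /andP[/asboolP].
pose S := \sum_(x <- cs) \prod_(y : gw_labels (f x) r) poisson_pmf (c / q`!%:R) (f x (val y)).
have XS : (P' (inside_event r m) <= S%:E)%E.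
  apply: (@le_trans _ _ (\sum_(x <- cs) P' [set w | gw_code r (K^~ w) = x])%E).
    apply: measure_bigcup_seq_le; first exact: measurable_inside_event.
      move=> x /csQ[k <- _]; exact: measurable_gw_code.
    move=> w [wU wm]; exists (gw_code r (K^~ w)) => //=.
    rewrite mem_undup mem_filter; apply/andP; split; first by apply/asboolP; exists (K^~ w).
    rewrite mem_pmap; apply/mapP; exists (choice.pickle (gw_code r (K^~ w))).
      by rewrite mem_iota.
    by rewrite choice.pickleK.
  rewrite /S -sumEFin big_seq [leRHS]big_seq; apply: lee_sum => x /csQ/fP[fx _].
  by rewrite -{1}fx (prob_gw_code PK).
(* The sum is finite, so termwise convergence suffices. Truncating the shapes has cost [e / 2]; the
   other half of [e] is spent on this limit. *)
have Scvg : (\sum_(x <- cs) shape_bound c (f x) r N) @[N --> \oo] --> S.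
  apply: cvg_big => [|x _]; first exact: add_continuous.
  exact: shape_bound_cvg.
near=> N.
have a01 : 0 < c / N%:R ^+ q < 1.
  by near: N; exact: erdos_renyi_parameter_near.
have N0 : (0 < N)%N by near: N; exists 1%N.
have SN : S - e / 2 <= \sum_(x <- cs) shape_bound c (f x) r N.
  have : `|S - \sum_(x <- cs) shape_bound c (f x) r N| <= e / 2.
    by near: N; move/cvgrPdist_le: Scvg; apply.
  by rewrite ler_norml => /andP[_]; lra.
apply: (@le_trans _ _ (\sum_(x <- cs) shape_bound c (f x) r N)%:E); last first.
  apply: mean_law_ge => [//||i]; first exact: open_measurable_Hstar.
  apply: (@le_trans _ _ (\sum_(x <- cs) P N (shape_event i (H N) r (f x)))%E).
    rewrite -sumEFin; apply: lee_sum => x _; exact: (shape_bound_le a01 (HER a01)).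
  apply: shape_event_le; [exact: open_measurable_Hstar|exact: undup_uniq| |].
    by move=> x /csQ/fP[].
  by move=> x /csQ/fP[_].
apply: (@le_trans _ _ (S - e / 2)%:E); last by rewrite lee_fin.
have := le_trans XU XS; rewrite !leeBlDr // -!EFinD => /le_trans; apply.
by rewrite lee_fin; lra.
Unshelve. all: by end_near. Qed.

End mean_law_lower.

Theorem theorem1p6 (R : realType) (p : nat) (c : R)
    (d : nat -> measure_display) (Omega : forall N : nat, measurableType (d N))
    (P : forall N : nat, probability (Omega N) R)
    (H : forall N : nat, random_hypergraph (Omega N) N)
    (d' : measure_display) (Omega' : measurableType d')
    (P' : probability Omega' R) (K : gw_label p.-1 -> {RV P' >-> nat})
    (hp : (2 <= p)%N) (hc : 0 < c)
    (hH : forall N : nat, 0 < c / N%:R ^+ p.-1 < 1 ->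
      erdos_renyi (P N) p (c / N%:R ^+ p.-1) (H N))
    (hK : poisson_offspring (c / (p.-1)`!%:R) K) :
  local_weak_cvg P H (gw_law K).
Proof.
case: p hp K hH hK => [//|q] hq K hH hK; apply: weak_cvg_open.
(* The mean law has mass 1 only for [N] positive. *)
- near=> N; apply: mean_lawT; near: N; by exists 1%N.
- exact: probability_setT.
- by move=> U oU e e0; have := mean_law_lower hq hc hH hK oU e0.
Unshelve. all: by end_near. Qed.
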